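(* Let $A$ be a commutative ring. The points of $\mathrm{SPEC}_{Dom}(A)$ are the $A$-algebras that are integral domains, and the points of $\mathrm{Spec}_{Dom}(A)$ are the quotients of $A$ that are integral domains.
   Context: $CRings$ is the category of commutative unital rings. $(Surj,Mono)$ is the unique factorisation system on $CRings$ with left class the surjections and right class the injective ring maps. A ring $K$ is a point of this system if $K\neq 0$ and every quotient map $K\to K/I$ with $I$ finitely generated and $K/I\neq0$ admits a retraction. A point covering family of a ring $B$ is a family $\{B\to B/I_i\}$ of quotients by finitely generated ideals such that every ring map $B\to K$ with $K$ a point factors through some $B\to B/I_i$. The associated topology is generated by these families. $\mathrm{Spec}_{Dom}(A)$ is the topos of sheaves for this topology on the opposite of the category of quotients of $A$ by finitely generated ideals (as $A$-algebras), and $\mathrm{SPEC}_{Dom}(A)$ is the topos of sheaves on the opposite of the category of finitely presented $A$-algebras. The category of points of a topos of sheaves on a site $\mathcal{D}$ with finite limits is identified with the full subcategory of $\mathrm{Pro}(\mathcal{D})$ of pro-objects having the lifting property through every covering family; pro-objects of the opposite of finitely presented $A$-algebras are $A$-algebras (with morphisms reversed), so the statement says that the category of points of $\mathrm{SPEC}_{Dom}(A)$, resp. $\mathrm{Spec}_{Dom}(A)$, is the opposite of the category of $A$-algebras of the stated kind. *)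

(* Defs.v *)
From HB Require Import structures.
From mathcomp Require Import all_boot all_order all_algebra.

Set Implicit Arguments.
Unset Strict Implicit.
Unset Printing Implicit Defensive.

Import GRing.Theory.
Local Open Scope ring_scope.

(* Categories have setoids of morphisms: [heq] is equality of morphisms. This
   lets morphisms of pro-objects be handled through representatives. *)
Record category := Category {
  obj :> Type;
  hom : obj -> obj -> Type;
  heq : forall X Y, hom X Y -> hom X Y -> Prop;
  idm : forall X, hom X X;
  comp : forall X Y Z, hom Y Z -> hom X Y -> hom X Z;
  heq_refl : forall X Y (f : hom X Y), heq f f;
  heq_sym : forall X Y (f g : hom X Y), heq f g -> heq g f;
  heq_trans : forall X Y (f g h : hom X Y), heq f g -> heq g h -> heq f h;
  heq_comp : forall X Y Z (g g' : hom Y Z) (f f' : hom X Y),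
    heq g g' -> heq f f' -> heq (comp g f) (comp g' f');
  comp_idl : forall X Y (f : hom X Y), heq (comp (idm Y) f) f;
  comp_idr : forall X Y (f : hom X Y), heq (comp f (idm X)) f;
  comp_assoc : forall X Y Z T (h : hom Z T) (g : hom Y Z) (f : hom X Y),
    heq (comp h (comp g f)) (comp (comp h g) f) }.

Arguments hom {c} X Y.
Arguments heq {c X Y} f g.
Arguments idm {c} X.
Arguments comp {c X Y Z} g f.

Notation "f =m g" := (heq f g) (at level 70, no associativity).
Notation "g \c f" := (comp g f) (at level 50, left associativity).

Definition op (C : category) : category.
Proof.
refine (@Category C (fun X Y => @hom C Y X) (fun X Y f g => f =m g)
  (fun X => idm X) (fun X Y Z g f => f \c g) _ _ _ _ _ _ _).
- by move=> X Y f; apply: heq_refl.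
- by move=> X Y f g; apply: heq_sym.
- by move=> X Y f g h; apply: heq_trans.
- by move=> X Y Z g g' f f' eg ef; apply: heq_comp.
- by move=> X Y f; apply: comp_idr.
- by move=> X Y f; apply: comp_idl.
- by move=> X Y Z T h g f; apply: heq_sym; apply: comp_assoc.
Defined.

Definition full (C : category) (P : C -> Prop) : category.
Proof.
refine (@Category {X : C | P X} (fun X Y => hom (sval X) (sval Y))
  (fun X Y f g => f =m g) (fun X => idm (sval X))
  (fun X Y Z g f => g \c f) _ _ _ _ _ _ _).
- by move=> X Y f; apply: heq_refl.
- by move=> X Y f g; apply: heq_sym.
- by move=> X Y f g h; apply: heq_trans.
- by move=> X Y Z g g' f f' eg ef; apply: heq_comp.
- by move=> X Y f; apply: comp_idl.
- by move=> X Y f; apply: comp_idr.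
- by move=> X Y Z T h g f; apply: comp_assoc.
Defined.

Record functor (C D : category) := Functor {
  fobj :> C -> D;
  fmap : forall X Y : C, hom X Y -> hom (fobj X) (fobj Y);
  fmap_heq : forall X Y (f g : hom X Y), f =m g -> fmap f =m fmap g;
  fmap_id : forall X, fmap (idm X) =m idm (fobj X);
  fmap_comp : forall X Y Z (g : hom Y Z) (f : hom X Y),
    fmap (g \c f) =m fmap g \c fmap f }.

Arguments fmap {C D} F {X Y} f : rename.

Definition functor_id (C : category) : functor C C.
Proof.
refine (@Functor C C (fun X => X) (fun X Y f => f) _ _ _).
- by [].
- by move=> X; apply: heq_refl.
- by move=> X Y Z g f; apply: heq_refl.
Defined.

Definition functor_comp (C D E : category) (G : functor D E) (F : functor C D) :
  functor C E.
Proof.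
refine (@Functor C E (fun X => G (F X)) (fun X Y f => fmap G (fmap F f)) _ _ _).
- by move=> X Y f g fg; do 2!apply: fmap_heq.
- move=> X; apply: heq_trans (fmap_id G (F X)).
  by apply: fmap_heq; apply: fmap_id.
- move=> X Y Z g f; apply: heq_trans (fmap_comp G (fmap F g) (fmap F f)).
  by apply: fmap_heq; apply: fmap_comp.
Defined.

Definition full_inclusion (C : category) (P : C -> Prop) : functor (full P) C.
Proof.
refine (@Functor (full P) C (fun X => sval X) (fun X Y f => f) _ _ _).
- by [].
- by move=> X; apply: heq_refl.
- by move=> X Y Z g f; apply: heq_refl.
Defined.

Definition functor_op (C D : category) (F : functor C D) :
  functor (op C) (op D).
Proof.
refine (@Functor (op C) (op D) (fun X => F X) (fun X Y f => @fmap C D F Y X f)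
  _ _ _).
- by move=> X Y f g; apply: (@fmap_heq C D F Y X).
- by move=> X; apply: (fmap_id F).
- by move=> X Y Z g f; apply: (@fmap_comp C D F Z Y X f g).
Defined.

Definition is_iso (C : category) (X Y : C) (f : hom X Y) : Prop :=
  exists g : hom Y X, g \c f =m idm X /\ f \c g =m idm Y.

Definition naturally_isomorphic (C D : category) (F G : functor C D) : Prop :=
  exists a : forall X, hom (F X) (G X),
    (forall X, is_iso (a X)) /\
    (forall X Y (f : hom X Y), a Y \c fmap F f =m fmap G f \c a X).

Definition is_equivalence (C D : category) (F : functor C D) : Prop :=
  exists G : functor D C,
    naturally_isomorphic (functor_comp G F) (functor_id C) /\
    naturally_isomorphic (functor_comp F G) (functor_id D).

(* Small cofiltered categories, the index categories of pro-objects. They are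
   kept apart from [category] so that they can live in the universe of the
   underlying sets of rings. *)
Record cofiltered := Cofiltered {
  idx :> Type;
  arr : idx -> idx -> Type;
  arr_id : forall i, arr i i;
  arr_comp : forall i j k, arr j k -> arr i j -> arr i k;
  arr_idl : forall i j (u : arr i j), arr_comp (arr_id j) u = u;
  arr_idr : forall i j (u : arr i j), arr_comp u (arr_id i) = u;
  arr_assoc : forall i j k l (w : arr k l) (v : arr j k) (u : arr i j),
    arr_comp w (arr_comp v u) = arr_comp (arr_comp w v) u;
  arr_inhabited : exists i : idx, True;
  arr_span : forall i j, exists k, exists (_ : arr k i) (_ : arr k j), True;
  arr_equalize : forall i j (u v : arr i j),
    exists k (w : arr k i), arr_comp u w = arr_comp v w }.

Arguments arr {c} i j.
Arguments arr_id {c} i.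
Arguments arr_comp {c i j k} v u.

Definition cofiltered_point : cofiltered.
Proof.
refine (@Cofiltered unit (fun _ _ => unit) (fun _ => tt) (fun _ _ _ _ _ => tt)
  _ _ _ _ _ _).
- by move=> i j [].
- by move=> i j [].
- by [].
- by exists tt.
- by move=> i j; exists tt, tt, tt.
- by move=> i j [] []; exists tt, tt.
Defined.

Record proobject (D : category) := Proobject {
  pro_idx : cofiltered;
  pro_obj :> pro_idx -> D;
  pro_map : forall i j : pro_idx, arr i j -> hom (pro_obj i) (pro_obj j);
  pro_map_id : forall i, pro_map (arr_id i) =m idm (pro_obj i);
  pro_map_comp : forall i j k (v : arr j k) (u : arr i j),
    pro_map (arr_comp v u) =m pro_map v \c pro_map u }.

Arguments pro_map {D} p {i j} u.

(* Equality of the classes of [f] and [g] in colim_i hom (P i) X. *)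
Definition germ_eq (D : category) (P : proobject D) (X : D)
    (i j : pro_idx P) (f : hom (P i) X) (g : hom (P j) X) : Prop :=
  exists k (u : arr k i) (v : arr k j), f \c pro_map P u =m g \c pro_map P v.

(* An element of lim_k colim_i hom (P i) (Q k), each component being given by a
   representative. *)
Record prohom (D : category) (P Q : proobject D) := Prohom {
  pro_src : pro_idx Q -> pro_idx P;
  pro_rep : forall k, hom (P (pro_src k)) (Q k);
  pro_compat : forall k l (v : arr k l),
    germ_eq (pro_map Q v \c pro_rep k) (pro_rep l) }.

Arguments pro_src {D P Q} p k.
Arguments pro_rep {D P Q} p k.

Definition prohom_eq (D : category) (P Q : proobject D) (f g : prohom P Q) :=
  forall k, germ_eq (pro_rep f k) (pro_rep g k).

Lemma germ_eq_heq (D : category) (P : proobject D) (X : D)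
    (i : pro_idx P) (f g : hom (P i) X) :
  f =m g -> germ_eq f g.
Proof.
move=> fg; exists i, (arr_id i), (arr_id i).
by apply: heq_comp fg _; apply: heq_refl.
Qed.

Lemma germ_eq_sym (D : category) (P : proobject D) (X : D)
    (i j : pro_idx P) (f : hom (P i) X) (g : hom (P j) X) : germ_eq f g -> germ_eq g f.
Proof. by case=> k [u [v e]]; exists k, v, u; apply: heq_sym. Qed.

Lemma germ_restrict (D : category) (P : proobject D) (X : D)
    (i k l : pro_idx P) (f : hom (P i) X)
    (u : arr k i) (w : arr l k) :
  f \c pro_map P (arr_comp u w) =m (f \c pro_map P u) \c pro_map P w.
Proof.
apply: heq_trans (comp_assoc _ _ _).
by apply: heq_comp (heq_refl _) (pro_map_comp _ _).
Qed.

Lemma germ_eq_trans (D : category) (P : proobject D) (X : D)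
    (i j l : pro_idx P) (f : hom (P i) X)
    (g : hom (P j) X) (h : hom (P l) X) :
  germ_eq f g -> germ_eq g h -> germ_eq f h.
Proof.
case=> k [u [v e]] [k' [u' [v' e']]].
have [m [a [b _]]] := arr_span k k'.
have [n [c ec]] := arr_equalize (arr_comp v a) (arr_comp u' b).
exists n, (arr_comp u (arr_comp a c)), (arr_comp v' (arr_comp b c)).
apply: heq_trans (germ_restrict _ _ _) _.
apply: heq_trans (heq_comp e (heq_refl _)) _.
apply: heq_trans (heq_sym (germ_restrict _ _ _)) _.
rewrite arr_assoc ec -arr_assoc.
apply: heq_trans (germ_restrict _ _ _) _.
apply: heq_trans (heq_comp e' (heq_refl _)) _.
by apply: heq_sym; apply: germ_restrict.
Qed.

Lemma germ_eq_post (D : category) (P : proobject D) (X Y : D)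
    (i j : pro_idx P) (f : hom (P i) X) (g : hom (P j) X) (h : hom X Y) :
  germ_eq f g -> germ_eq (h \c f) (h \c g).
Proof.
case=> k [u [v e]]; exists k, u, v.
apply: heq_trans (heq_sym (comp_assoc _ _ _)) _.
apply: heq_trans (comp_assoc _ _ _).
by apply: heq_comp (heq_refl _) e.
Qed.

Lemma germ_eq_prohom (D : category) (P Q : proobject D) (X : D)
    (f : prohom P Q) (i j : pro_idx Q) (g : hom (Q i) X) (h : hom (Q j) X) :
  germ_eq g h -> germ_eq (g \c pro_rep f i) (h \c pro_rep f j).
Proof.
have restr m l (v : arr m l) (t : hom (Q l) X) :
    germ_eq ((t \c pro_map Q v) \c pro_rep f m) (t \c pro_rep f l).
  apply: germ_eq_trans (germ_eq_heq (heq_sym (comp_assoc _ _ _))) _.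
  by apply: germ_eq_post; apply: pro_compat.
case=> k [u [v e]].
apply: germ_eq_trans (germ_eq_sym (restr _ _ u g)) _.
apply: germ_eq_trans (restr _ _ v h).
by apply: germ_eq_heq; apply: heq_comp e (heq_refl _).
Qed.

Definition prohom_id (D : category) (P : proobject D) : prohom P P.
Proof.
refine (@Prohom D P P (fun k => k) (fun k => idm (P k)) _).
move=> k l v; exists k, (arr_id k), v => /=.
apply: heq_trans (heq_comp (comp_idr _) (pro_map_id _)) _.
apply: heq_trans (comp_idr _) _.
by apply: heq_sym; apply: comp_idl.
Defined.

Definition prohom_comp (D : category) (P Q R : proobject D)
  (g : prohom Q R) (f : prohom P Q) : prohom P R.
Proof.
refine (@Prohom D P R (fun k => pro_src f (pro_src g k))
  (fun k => pro_rep g k \c pro_rep f (pro_src g k)) _).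
move=> k l v.
apply: germ_eq_trans (germ_eq_heq (comp_assoc _ _ _)) _.
by apply: germ_eq_prohom; apply: pro_compat.
Defined.

Definition Pro (D : category) : category.
Proof.
refine (@Category (proobject D) (@prohom D) (@prohom_eq D) (@prohom_id D)
  (@prohom_comp D) _ _ _ _ _ _ _).
- by move=> P Q f k; apply: germ_eq_heq; apply: heq_refl.
- by move=> P Q f g e k; apply: germ_eq_sym.
- by move=> P Q f g h e e' k; apply: germ_eq_trans (e k) (e' k).
- move=> P Q R g g' f f' eg ef k /=.
  apply: germ_eq_trans (germ_eq_prohom f (eg k)) _.
  by apply: germ_eq_post; apply: ef.
- by move=> P Q f k; apply: germ_eq_heq; apply: comp_idl.
- by move=> P Q f k; apply: germ_eq_heq; apply: comp_idr.
- by move=> P Q R S h g f k; apply: germ_eq_heq; apply: comp_assoc.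
Defined.

Definition pro_const_obj (D : category) (X : D) : proobject D.
Proof.
refine (@Proobject D cofiltered_point (fun _ => X) (fun _ _ _ => idm X) _ _).
- by move=> i; apply: heq_refl.
- by move=> i j k v u; apply: heq_sym; apply: comp_idl.
Defined.

Definition pro_const_hom (D : category) (X Y : D) (f : hom X Y) :
  prohom (pro_const_obj X) (pro_const_obj Y).
Proof.
refine (@Prohom D (pro_const_obj X) (pro_const_obj Y) (fun _ => tt)
  (fun _ => f) _).
move=> k l v; exists tt, tt, tt.
by apply: heq_comp (heq_refl _); apply: comp_idl.
Defined.

Definition pro_const (D : category) : functor D (Pro D).
Proof.
refine (@Functor D (Pro D) (@pro_const_obj D) (@pro_const_hom D) _ _ _).
- by move=> X Y f g e k; exists tt, tt, tt; apply: heq_comp e (heq_refl _).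
- by move=> X k; exists tt, tt, tt; apply: heq_refl.
- by move=> X Y Z g f k; exists tt, tt, tt; apply: heq_refl.
Defined.

Definition pro_image (D E : category) (U : functor D E) (P : proobject D) :
  proobject E.
Proof.
refine (@Proobject E (pro_idx P) (fun i => U (P i))
  (fun i j u => fmap U (pro_map P u)) _ _).
- move=> i; apply: heq_trans (fmap_id U (P i)).
  by apply: fmap_heq; apply: pro_map_id.
- move=> i j k v u; apply: heq_trans (fmap_comp U _ _).
  by apply: fmap_heq; apply: pro_map_comp.
Defined.

Definition is_cone (E : category) (P : proobject E) (L : E)
    (p : forall i, hom L (P i)) : Prop :=
  forall i j (u : arr i j), pro_map P u \c p i =m p j.

Definition is_limit (E : category) (P : proobject E) (L : E)
    (p : forall i, hom L (P i)) : Prop :=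
  is_cone p /\
  forall (M : E) (q : forall i, hom M (P i)), is_cone q ->
    exists f : hom M L, (forall i, p i \c f =m q i) /\
      (forall g : hom M L, (forall i, p i \c g =m q i) -> g =m f).

(* [F], defined on a full subcategory of Pro(D), is P |-> lim_i U (P i), on
   objects and on morphisms. For E the opposite of a category of algebras this
   limit is the filtered colimit of the algebras P i. *)
Definition computes_limits (D E : category) (U : functor D E)
    (T : Pro D -> Prop) (F : functor (full T) E) : Prop :=
  exists p : forall (P : full T) (i : pro_idx (sval P)),
      hom (F P) (U (sval P i)),
    (forall P, @is_limit E (pro_image U (sval P)) (F P) (p P)) /\
    (forall (P Q : full T) (f : @prohom D (sval P) (sval Q))
        (k : pro_idx (sval Q)),
      p Q k \c @fmap _ _ F P Q f =m fmap U (pro_rep f k) \c p P (pro_src f k)).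

Record family (D : category) (X : D) := Family {
  fam_idx :> Type;
  fam_src : fam_idx -> D;
  fam_map : forall i, hom (fam_src i) X }.

Arguments fam_src {D X} f i.
Arguments fam_map {D X} f i.

Definition coverage (D : category) := forall X : D, family X -> Prop.

Record sieve (D : category) (X : D) := Sieve {
  in_sieve :> forall Y : D, hom Y X -> Prop;
  sieve_heq : forall Y (f g : hom Y X), f =m g -> in_sieve f -> in_sieve g;
  sieve_comp : forall Y Z (f : hom Y X) (g : hom Z Y),
    in_sieve f -> in_sieve (f \c g) }.

Arguments in_sieve {D X} s {Y} _.

Definition sieve_pullback (D : category) (X Y : D) (h : hom Y X)
  (S : sieve X) : sieve Y.
Proof.
refine (@Sieve D Y (fun Z f => in_sieve S (h \c f)) _ _).
- move=> Z f g e; apply: sieve_heq.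
  by apply: heq_comp e; apply: heq_refl.
- move=> Z T f g Sf; apply: sieve_heq (heq_sym (comp_assoc _ _ _)) _.
  exact: sieve_comp.
Defined.

Definition generated_sieve (D : category) (X : D) (F : family X) : sieve X.
Proof.
refine (@Sieve D X
  (fun Y f => exists i (g : hom Y (fam_src F i)), fam_map F i \c g =m f) _ _).
- by move=> Y f f' e [i [g eg]]; exists i, g; apply: heq_trans e.
- move=> Y Z f h [i [g eg]]; exists i, (g \c h).
  apply: heq_trans (comp_assoc _ _ _) _.
  by apply: heq_comp eg (heq_refl _).
Defined.

Definition grothendieck_topology (D : category)
    (J : forall X : D, sieve X -> Prop) : Prop :=
  [/\ forall X (S : sieve X), (forall Y (f : hom Y X), in_sieve S f) -> J X S,
      forall X Y (h : hom Y X) (S : sieve X),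
        J X S -> J Y (sieve_pullback h S) &
      forall X (S R : sieve X), J X S ->
        (forall Y (f : hom Y X), in_sieve S f -> J Y (sieve_pullback f R)) ->
        J X R].

Definition generated_topology (D : category) (K : coverage D)
    (X : D) (S : sieve X) : Prop :=
  forall J : (forall X : D, sieve X -> Prop),
    grothendieck_topology J ->
    (forall Y (F : family Y), K Y F -> J Y (generated_sieve F)) ->
    J X S.

Definition covering_family (D : category) (K : coverage D)
    (X : D) (F : family X) : Prop :=
  generated_topology K (generated_sieve F).

Definition lifts_through (D : category) (P : Pro D) (X : D)
    (F : family X) : Prop :=
  forall f : hom P (pro_const D X),
    exists i (g : hom P (pro_const D (fam_src F i))),
      fmap (pro_const D) (fam_map F i) \c g =m f.

Definition is_topos_point (D : category) (K : coverage D) (P : Pro D) : Prop :=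
  forall (X : D) (F : family X), covering_family K F -> lifts_through P F.

(* For [D] with finite limits, the category of points of the topos of sheaves
   on [D] for the topology generated by [K]. *)
Definition topos_points (D : category) (K : coverage D) : category :=
  full (is_topos_point K).

(* Unlike [comAlgType], this allows zero algebras and a zero base ring. *)
Record algebra (A : comPzRingType) := Algebra {
  alg_ring :> comPzRingType;
  alg_str : {rmorphism A -> alg_ring} }.

Arguments alg_str {A} a.

Record alg_hom (A : comPzRingType) (B C : algebra A) := AlgHom {
  alg_fun :> {rmorphism B -> C};
  alg_funE : forall a, alg_fun (alg_str B a) = alg_str C a }.

Definition alg_id (A : comPzRingType) (B : algebra A) : alg_hom B B.
Proof. by refine (@AlgHom A B B idfun _). Defined.

Definition alg_comp (A : comPzRingType) (B C D : algebra A)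
  (g : alg_hom C D) (f : alg_hom B C) : alg_hom B D.
Proof.
refine (@AlgHom A B D (alg_fun g \o alg_fun f) _).
by move=> a /=; rewrite !alg_funE.
Defined.

Definition Alg (A : comPzRingType) : category.
Proof.
refine (@Category (algebra A) (@alg_hom A) (fun B C f g => f =1 g)
  (@alg_id A) (@alg_comp A) _ _ _ _ _ _ _) => //=.
- by move=> B C f g e x; rewrite e.
- by move=> B C f g h e e' x; rewrite e e'.
- by move=> B C D g g' f f' eg ef x /=; rewrite ef eg.
Defined.

(* [q] is, up to isomorphism, a quotient map B -> B/I with I a finitely
   generated ideal. *)
Definition fg_quotient (B Q : comPzRingType) (q : {rmorphism B -> Q}) : Prop :=
  (forall y, exists x, q x = y) /\
  exists n (s : 'I_n -> B), forall x,
    q x = 0 <-> exists c : 'I_n -> B, x = \sum_(i < n) c i * s i.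

(* [P] is the polynomial algebra over A on the variables [x]. *)
Definition polynomial_algebra (A : comPzRingType) (n : nat) (P : algebra A)
    (x : 'I_n -> P) : Prop :=
  forall (B : algebra A) (b : 'I_n -> B),
    exists f : alg_hom P B, (forall i, f (x i) = b i) /\
      (forall g : alg_hom P B, (forall i, g (x i) = b i) -> g =1 f).

Definition finitely_presented (A : comPzRingType) (B : algebra A) : Prop :=
  exists n (P : algebra A) (x : 'I_n -> P) (q : alg_hom P B),
    polynomial_algebra x /\ fg_quotient q.

Definition factorisation_point (K : comPzRingType) : Prop :=
  (1 : K) <> 0 /\
  forall (Q : comPzRingType) (q : {rmorphism K -> Q}),
    fg_quotient q -> (1 : Q) <> 0 ->
    exists r : {rmorphism Q -> K}, forall x, r (q x) = x.

Definition opposite_site (A : comPzRingType) (T : Alg A -> Prop) : category :=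
  op (full T).

(* A morphism Q -> B of the opposite category is an algebra map B -> Q. *)
Definition point_covering (A : comPzRingType) (T : Alg A -> Prop) :
    coverage (opposite_site T) :=
  fun (B : opposite_site T) (F : family B) =>
    (forall i, fg_quotient (alg_fun (fam_map F i))) /\
    forall (K : comPzRingType) (f : {rmorphism sval B -> K}),
      factorisation_point K ->
      exists i (g : {rmorphism sval (fam_src F i) -> K}),
        forall b, f b = g (alg_fun (fam_map F i) b).

Definition fg_quotient_algebra (A : comPzRingType) (B : algebra A) : Prop :=
  fg_quotient (alg_str B).

Definition SPEC_Dom_points (A : comPzRingType) : category :=
  topos_points (@point_covering A (@finitely_presented A)).

Definition Spec_Dom_points (A : comPzRingType) : category :=
  topos_points (@point_covering A (@fg_quotient_algebra A)).

Definition integral_domain (R : comPzRingType) : Prop :=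
  (1 : R) <> 0 /\ GRing.integral_domain_axiom R.

Definition domain_algebra (A : comPzRingType) (B : Alg A) : Prop :=
  integral_domain (alg_ring B).

Definition domain_quotient (A : comPzRingType) (B : Alg A) : Prop :=
  (forall b : alg_ring B, exists a, alg_str B a = b) /\
  integral_domain (alg_ring B).

Definition op_inclusion (A : comPzRingType) (V : Alg A -> Prop) :
    functor (op (full V)) (op (Alg A)) :=
  functor_op (full_inclusion V).

(* Main.v *)
From HB Require Import structures.
Require Import Defs.
From mathcomp Require Import all_boot all_algebra.
From mathcomp Require Import boolp.
(* So that [hom] denotes the morphisms of a category, not linear maps. *)
Import Defs.

(** A point [K] of the factorisation system is a field: a retraction of
    [K -> K/I] forces [I = 0], so every proper finitely generated ideal of [K]
    vanishes; conversely fields are visibly points. Both halves of the theorem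
    concern a full subcategory [T] of finitely presented [A]-algebras that is
    closed under quotients by finitely generated ideals. A pro-object of the
    opposite of [T] is a filtered diagram [P] of algebras in [T]; let [L] be its
    colimit.

    If [P] is a topos point then [L] is a domain ([topos_point_domain]). An
    equation [x y = 0] in [L] holds already in some stage [C] of [P], and the
    quotients of [C] by [x] and by [y] form a point covering family, since a
    map from [C] to a field kills [x] or [y]. Lifting through it kills [x] or
    [y] at a later stage. Likewise the zero ring has the empty covering family,
    whence [L <> 0].

    If [L] is a domain then [P] is a topos point ([domain_topos_point]). The
    field of fractions of [L] is a point, so for a point covering family of [C]
    and a map [f : C -> L], the composite of [f] with the embedding of [L] in
    this field kills the ideal [I] of one of the quotients. The embedding is
    injective, so [f] kills [I]; as [I] is finitely generated, this happens at a
    finite stage. That all covering families lift, and not only the generating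
    ones, holds because the sieves through which every map from [P] eventually
    factors form a Grothendieck topology ([stage_lifts_topology]).

    Taking colimits is fully faithful on diagrams of finitely presented
    algebras, since such algebras are compact: a map from one of them to [L]
    comes from a stage ([fp_lift]), and two maps to stages that agree in [L]
    agree at a later stage ([fp_sep]). The essential image is the class of
    domains that are filtered colimits of algebras in [T]
    ([points_as_colimits]). Finally, an algebra generated by a set [X] is the
    filtered colimit of its finite presentations on generators in [X] and
    finitely many relations ([presentation_colimit]). Taking for [X] the algebra
    itself shows that every algebra is a colimit of finitely presented ones;
    taking for [X] the empty set shows that every quotient of [A] is a colimit
    of quotients by finitely generated ideals. *)

Set Implicit Arguments.
Unset Strict Implicit.
Unset Printing Implicit Defensive.

Import GRing.Theory.
Local Open Scope ring_scope.

(** * Algebras up to an equivalence relation *)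

(** The laws hold only up to [wa_eq], so that quotient algebras, free algebras
    and filtered colimits all arise by taking classes of an evident structure.
    Zero and one are the constants [0] and [1] of [A]. *)
Record weak_algebra (A : comPzRingType) := WeakAlgebra {
  wa_car :> Type;
  wa_eq : wa_car -> wa_car -> Prop;
  wa_const : A -> wa_car;
  wa_opp : wa_car -> wa_car;
  wa_add : wa_car -> wa_car -> wa_car;
  wa_mul : wa_car -> wa_car -> wa_car;
  wa_refl : forall x, wa_eq x x;
  wa_sym : forall x y, wa_eq x y -> wa_eq y x;
  wa_trans : forall x y z, wa_eq x y -> wa_eq y z -> wa_eq x z;
  wa_opp_eq : forall x x', wa_eq x x' -> wa_eq (wa_opp x) (wa_opp x');
  wa_add_eq : forall x x' y y', wa_eq x x' -> wa_eq y y' ->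
    wa_eq (wa_add x y) (wa_add x' y');
  wa_mul_eq : forall x x' y y', wa_eq x x' -> wa_eq y y' ->
    wa_eq (wa_mul x y) (wa_mul x' y');
  wa_addA : forall x y z,
    wa_eq (wa_add x (wa_add y z)) (wa_add (wa_add x y) z);
  wa_addC : forall x y, wa_eq (wa_add x y) (wa_add y x);
  wa_add0 : forall x, wa_eq (wa_add (wa_const 0) x) x;
  wa_addN : forall x, wa_eq (wa_add (wa_opp x) x) (wa_const 0);
  wa_mulA : forall x y z,
    wa_eq (wa_mul x (wa_mul y z)) (wa_mul (wa_mul x y) z);
  wa_mulC : forall x y, wa_eq (wa_mul x y) (wa_mul y x);
  wa_mul1 : forall x, wa_eq (wa_mul (wa_const 1) x) x;
  wa_mulDl : forall x y z,
    wa_eq (wa_mul (wa_add x y) z) (wa_add (wa_mul x z) (wa_mul y z));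
  wa_constB : forall a b,
    wa_eq (wa_const (a - b)) (wa_add (wa_const a) (wa_opp (wa_const b)));
  wa_constM : forall a b,
    wa_eq (wa_const (a * b)) (wa_mul (wa_const a) (wa_const b)) }.

Section Strictify.
Variables (A : comPzRingType) (W : weak_algebra A).

Definition strict_rel : rel {classic W} := fun x y => `[< wa_eq x y >].

Lemma strict_rel_refl : reflexive strict_rel.
Proof. by move=> x; apply/asboolP/wa_refl. Qed.

Lemma strict_rel_sym : symmetric strict_rel.
Proof. by move=> x y; apply/asboolP/asboolP; apply: wa_sym. Qed.

Lemma strict_rel_trans : transitive strict_rel.
Proof.
by move=> y x z /asboolP xy /asboolP yz; apply/asboolP; apply: wa_trans xy yz.
Qed.

Definition strict_equiv :=
  EquivRel strict_rel strict_rel_refl strict_rel_sym strict_rel_trans.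

Definition strict := {eq_quot strict_equiv}%qT.
HB.instance Definition _ := Choice.on strict.

Definition strict_pi (x : W) : strict := (\pi_strict (x : {classic W}))%qT.
Definition strict_repr (c : strict) : W := repr c.

Lemma strict_reprK c : strict_pi (strict_repr c) = c.
Proof. exact: reprK. Qed.

Lemma strict_piP x y : strict_pi x = strict_pi y <-> wa_eq x y.
Proof. by split=> [/eqmodP/asboolP|e]; last apply/eqmodP/asboolP. Qed.

Lemma strict_reprP x : wa_eq (strict_repr (strict_pi x)) x.
Proof. by apply/strict_piP; apply: strict_reprK. Qed.

Definition strict_opp c := strict_pi (wa_opp (strict_repr c)).
Definition strict_add c d :=
  strict_pi (wa_add (strict_repr c) (strict_repr d)).
Definition strict_mul c d :=
  strict_pi (wa_mul (strict_repr c) (strict_repr d)).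

Lemma strict_piN x : strict_pi (wa_opp x) = strict_opp (strict_pi x).
Proof. by apply/strict_piP/wa_opp_eq/wa_sym/strict_reprP. Qed.

Lemma strict_piD x y :
  strict_pi (wa_add x y) = strict_add (strict_pi x) (strict_pi y).
Proof. by apply/strict_piP/wa_add_eq; apply/wa_sym/strict_reprP. Qed.

Lemma strict_piM x y :
  strict_pi (wa_mul x y) = strict_mul (strict_pi x) (strict_pi y).
Proof. by apply/strict_piP/wa_mul_eq; apply/wa_sym/strict_reprP. Qed.

Lemma strict_ind (P : strict -> Prop) :
  (forall x, P (strict_pi x)) -> forall c, P c.
Proof. by move=> Ppi c; rewrite -(strict_reprK c). Qed.

Lemma strict_addA : associative strict_add.
Proof.
do 3!elim/strict_ind=> ?.
by rewrite -!strict_piD; apply/strict_piP/wa_addA.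
Qed.

Lemma strict_addC : commutative strict_add.
Proof.
by do 2!elim/strict_ind=> ?; rewrite -!strict_piD; apply/strict_piP/wa_addC.
Qed.

Lemma strict_add0 : left_id (strict_pi (wa_const W 0)) strict_add.
Proof.
by elim/strict_ind=> ?; rewrite -strict_piD; apply/strict_piP/wa_add0.
Qed.

Lemma strict_addN :
  left_inverse (strict_pi (wa_const W 0)) strict_opp strict_add.
Proof.
elim/strict_ind=> ?.
by rewrite -strict_piN -strict_piD; apply/strict_piP/wa_addN.
Qed.

HB.instance Definition _ := GRing.isZmodule.Build strict
  strict_addA strict_addC strict_add0 strict_addN.

Lemma strict_mulA : associative strict_mul.
Proof.
do 3!elim/strict_ind=> ?.
by rewrite -!strict_piM; apply/strict_piP/wa_mulA.
Qed.

Lemma strict_mulC : commutative strict_mul.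
Proof.
by do 2!elim/strict_ind=> ?; rewrite -!strict_piM; apply/strict_piP/wa_mulC.
Qed.

Lemma strict_mul1 : left_id (strict_pi (wa_const W 1)) strict_mul.
Proof.
by elim/strict_ind=> ?; rewrite -strict_piM; apply/strict_piP/wa_mul1.
Qed.

Lemma strict_mulDl : left_distributive strict_mul strict_add.
Proof.
do 3!elim/strict_ind=> ?; rewrite -strict_piD -!strict_piM -strict_piD.
by apply/strict_piP/wa_mulDl.
Qed.

HB.instance Definition _ := GRing.Zmodule_isComPzRing.Build strict
  strict_mulA strict_mulC strict_mul1 strict_mulDl.

Definition strict_str (a : A) : strict := strict_pi (wa_const W a).

Lemma strict_str_zmod : zmod_morphism strict_str.
Proof.
move=> a b; rewrite /strict_str; have /strict_piP-> := wa_constB W a b.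
by rewrite strict_piD strict_piN.
Qed.

Lemma strict_str_monoid : monoid_morphism strict_str.
Proof.
split=> // a b; rewrite /strict_str; have /strict_piP-> := wa_constM W a b.
by rewrite strict_piM.
Qed.

HB.instance Definition _ :=
  GRing.isZmodMorphism.Build A strict strict_str strict_str_zmod.
HB.instance Definition _ :=
  GRing.isMonoidMorphism.Build A strict strict_str strict_str_monoid.

Definition strict_algebra : algebra A :=
  @Algebra A (strict : comPzRingType) (strict_str : {rmorphism A -> strict}).

End Strictify.

Record class_map (A : comPzRingType) (W : weak_algebra A) (Q : algebra A)
    (pi : W -> Q) : Prop := {
  class_surj : forall y, exists x, pi x = y;
  class_eq : forall x y, pi x = pi y <-> wa_eq x y;
  class_const : forall a, pi (wa_const W a) = alg_str Q a;
  class_opp : forall x, pi (wa_opp x) = - pi x;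
  class_add : forall x y, pi (wa_add x y) = pi x + pi y;
  class_mul : forall x y, pi (wa_mul x y) = pi x * pi y }.

Lemma strict_class_map (A : comPzRingType) (W : weak_algebra A) :
  @class_map A W (strict_algebra W) (@strict_pi A W).
Proof.
split=> //.
- by move=> c; exists (strict_repr c); apply: strict_reprK.
- exact: strict_piP.
- exact: strict_piN.
- exact: strict_piD.
- exact: strict_piM.
Qed.

(** * Surjections and finitely generated ideals *)

Lemma alg_hom_of (A : comPzRingType) (B C : algebra A) (f : B -> C) :
    zmod_morphism f -> monoid_morphism f ->
    (forall a, f (alg_str B a) = alg_str C a) ->
  exists g : alg_hom B C, g =1 f.
Proof.
move=> fB fM fA.
pose g : {rmorphism B -> C} := HB.pack_for {rmorphism B -> C} f
  (GRing.isZmodMorphism.Build _ _ f fB) (GRing.isMonoidMorphism.Build _ _ f fM).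
by exists (@AlgHom A B C g fA).
Qed.

(** The factorisation is [f] applied to arbitrary preimages; the kernel
    condition makes the result independent of their choice. *)
Lemma factor_surjection (B Q C : comPzRingType) (q : {rmorphism B -> Q})
    (f : {rmorphism B -> C}) :
    (forall y, exists x, q x = y) -> (forall x, q x = 0 -> f x = 0) ->
  exists g : {rmorphism Q -> C}, forall x, g (q x) = f x.
Proof.
move=> /choice[s qs] qf.
have sq x : f (s (q x)) = f x.
  by apply/eqP; rewrite -subr_eq0 -rmorphB qf // rmorphB qs subrr.
have gB : zmod_morphism (f \o s).
  by move=> x y; rewrite /= -{1}(qs x) -{1}(qs y) -rmorphB sq rmorphB.
have gM : monoid_morphism (f \o s).
  split=> [|x y]; first by rewrite /= -(rmorph1 q) sq rmorph1.
  by rewrite /= -{1}(qs x) -{1}(qs y) -rmorphM sq rmorphM.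
pose g : {rmorphism Q -> C} := HB.pack_for {rmorphism Q -> C} (f \o s)
  (GRing.isZmodMorphism.Build _ _ _ gB) (GRing.isMonoidMorphism.Build _ _ _ gM).
by exists g.
Qed.

Lemma factor_alg_surjection (A : comPzRingType) (B Q C : algebra A)
    (q : alg_hom B Q) (f : alg_hom B C) :
    (forall y, exists x, q x = y) -> (forall x, q x = 0 -> f x = 0) ->
  exists g : alg_hom Q C, forall x, g (q x) = f x.
Proof.
move=> qsurj qf; have [g gq] := factor_surjection qsurj qf.
have gA a : g (alg_str Q a) = alg_str C a by rewrite -(alg_funE q) gq alg_funE.
by exists (@AlgHom A Q C g gA).
Qed.

Definition ideal (R : comPzRingType) (I : R -> Prop) : Prop :=
  [/\ I 0, forall x y, I x -> I y -> I (x + y) &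
      forall a x, I x -> I (a * x)].

(** Defined as the smallest ideal containing [s] rather than by linear
    combinations, so that inclusions are proved by checking generators. *)
Definition ideal_span (R : comPzRingType) (s : seq R) (x : R) : Prop :=
  forall I, ideal I -> (forall y, y \in s -> I y) -> I x.

Lemma ideal_kernel (R S : comPzRingType) (f : {rmorphism R -> S}) :
  ideal (fun x => f x = 0).
Proof.
split=> [|x y fx fy|a x fx]; first exact: rmorph0.
  by rewrite rmorphD fx fy addr0.
by rewrite rmorphM fx mulr0.
Qed.

Lemma ideal_preim (R S : comPzRingType) (f : {rmorphism R -> S}) I :
  ideal I -> ideal (fun x => I (f x)).
Proof.
case=> I0 ID IM; split=> [|x y Ix Iy|a x Ix]; first by rewrite rmorph0.
  by rewrite rmorphD; apply: ID.
by rewrite rmorphM; apply: IM.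
Qed.

Lemma span_ideal (R : comPzRingType) (s : seq R) : ideal (ideal_span s).
Proof.
split=> [I [] //|x y sx sy I II sI|a x sx I II sI]; case: (II) => _ ID IM.
  by apply: ID; [apply: sx | apply: sy].
by apply: IM; apply: sx.
Qed.

Lemma mem_span (R : comPzRingType) (s : seq R) x : x \in s -> ideal_span s x.
Proof. by move=> xs I _; apply. Qed.

Lemma span_min (R : comPzRingType) (s : seq R) (I : R -> Prop) x :
  ideal I -> (forall y, y \in s -> I y) -> ideal_span s x -> I x.
Proof. by move=> II sI; apply. Qed.

Lemma span_subset (R : comPzRingType) (s t : seq R) x :
  {subset s <= t} -> ideal_span s x -> ideal_span t x.
Proof. by move=> st; apply: span_min (span_ideal t) _ => y /st/mem_span. Qed.

Lemma span_map (R S : comPzRingType) (f : {rmorphism R -> S}) (s : seq R) x :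
  ideal_span s x -> ideal_span (map f s) (f x).
Proof.
apply: (span_min (ideal_preim f (span_ideal _))) => y ys.
by apply: mem_span; apply: map_f.
Qed.

(** The linear combinations of the [s i] form an ideal that contains them, and
    they lie in every such ideal. *)
Lemma span_sumP (R : comPzRingType) n (s : 'I_n -> R) x :
  ideal_span (codom s) x <-> exists c : 'I_n -> R, x = \sum_(i < n) c i * s i.
Proof.
split=> [|[c ->]]; last first.
  have [I0 ID IM] := span_ideal (codom s).
  by apply: big_ind => // i _; apply: IM; apply: mem_span; apply: codom_f.
apply: (span_min (I := fun x : R => exists c : 'I_n -> R,
    x = \sum_(i < n) c i * s i)).
  split=> [|_ _ [c ->] [d ->]|a _ [c ->]].
  - by exists (fun=> 0); rewrite big1 // => i _; rewrite mul0r.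
  - exists (fun i => c i + d i); rewrite -big_split.
    by apply: eq_bigr => i _; rewrite mulrDl.
  - exists (fun i => a * c i); rewrite mulr_sumr.
    by apply: eq_bigr => i _; rewrite mulrA.
move=> y /codomP[i ->].
exists (fun j => (j == i)%:R); rewrite (bigD1 i) //= eqxx mul1r big1 ?addr0 //.
by move=> j /negPf ->; rewrite mul0r.
Qed.

Lemma fg_quotientP (B Q : comPzRingType) (q : {rmorphism B -> Q}) :
  fg_quotient q <-> (forall y, exists x, q x = y) /\
    exists s : seq B, forall x, q x = 0 <-> ideal_span s x.
Proof.
split=> [] [qsurj].
  case=> n [s qs]; split=> //; exists (codom s) => x.
  by rewrite qs span_sumP.
case=> s qs; split=> //; exists (size s), (tnth (in_tuple s)) => x.
by rewrite qs -span_sumP codomE map_tnth_enum.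
Qed.

(** The kernel of the composite is generated by generators of the first kernel
    together with lifts of generators of the second. *)
Lemma fg_quotient_comp (B C D : comPzRingType) (q : {rmorphism B -> C})
    (r : {rmorphism C -> D}) (h : {rmorphism B -> D}) :
  h =1 r \o q -> fg_quotient q -> fg_quotient r -> fg_quotient h.
Proof.
move=> hE /fg_quotientP[qsurj [s qs]] /fg_quotientP[rsurj [t rt]].
have [u qu] := choice qsurj.
apply/fg_quotientP; split=> [z|].
  by have [y <-] := rsurj z; have [x <-] := qsurj y; exists x.
exists (s ++ map u t) => x; rewrite hE /=; split=> [/rt|]; last first.
  apply: (span_min (ideal_kernel (r \o q))) => y /=.
  rewrite mem_cat => /orP[/mem_span/qs->|/mapP[z zt ->]]; first exact: rmorph0.
  by rewrite qu; apply/rt; apply: mem_span.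
pose J := ideal_span (s ++ map u t); have [I0 ID IM] : ideal J := span_ideal _.
have qJ w : q w = 0 -> J w.
  by move/qs; apply: span_subset => y; rewrite mem_cat => ->.
(* Membership in the second kernel is propagated over all preimages at once,
   because the lifts of a sum or a multiple are determined only modulo [J]. *)
suff /[apply]/(_ x erefl) :
    forall z, ideal_span t z -> forall w, q w = z -> J w by [].
move=> z; apply: (span_min (I := fun z => forall w, q w = z -> J w)).
  split=> [//|y y' IHy IHy' w qw|a y IHy w qw].
  - rewrite -(subrK (u y') w); apply: ID; last exact: IHy'.
    by apply: IHy; rewrite rmorphB qw qu addrK.
  - rewrite -(subrK (u a * u y) w); apply: ID; last exact: IM (IHy _ (qu _)).
    by apply: qJ; rewrite rmorphB rmorphM qw !qu subrr.
move=> y yt w qw; rewrite -(subrK (u y) w); apply: ID.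
  by apply: qJ; rewrite rmorphB qw qu subrr.
by apply: mem_span; rewrite mem_cat map_f ?orbT.
Qed.

Lemma fg_quotient_id (B : comPzRingType) (q : {rmorphism B -> B}) :
  q =1 id -> fg_quotient q.
Proof.
move=> qE; apply/fg_quotientP; split=> [y|]; first by exists y; rewrite qE.
exists [::] => x; rewrite qE; split=> [->|sx].
  by have [] := span_ideal (Nil B).
by rewrite -[x]qE; apply: (span_min (ideal_kernel q)) sx.
Qed.

(** * Quotient algebras and free algebras *)

Lemma idealD (R : comPzRingType) (I : R -> Prop) :
  ideal I -> forall x y, I x -> I y -> I (x + y).
Proof. by case. Qed.

Lemma idealM (R : comPzRingType) (I : R -> Prop) :
  ideal I -> forall a x, I x -> I (a * x).
Proof. by case. Qed.

Lemma idealN (R : comPzRingType) (I : R -> Prop) :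
  ideal I -> forall x, I x -> I (- x).
Proof. by move=> II x Ix; rewrite -mulN1r; apply: idealM. Qed.

Lemma ideal_eq (R : comPzRingType) (I : R -> Prop) :
  ideal I -> forall x y, x = y -> I (x - y).
Proof. by case=> I0 _ _ x y ->; rewrite subrr. Qed.

Definition ideal_weak_algebra (A : comPzRingType) (C : algebra A)
  (I : C -> Prop) (II : ideal I) : weak_algebra A.
Proof.
refine (@WeakAlgebra A C (fun x y => I (x - y)) (alg_str C) -%R +%R *%R
  _ _ _ _ _ _ _ _ _ _ _ _ _ _ _ _).
- by move=> x; apply: ideal_eq.
- by move=> x y /(idealN II); rewrite opprB.
- by move=> x y z xy /(idealD II xy); rewrite addrA subrK.
- by move=> x y /(idealN II); rewrite opprD.
- by move=> x x' y y' xx' /(idealD II xx'); rewrite opprD addrACA.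
- move=> x x' y y' xx' yy'.
  rewrite (_ : _ - _ = y * (x - x') + x' * (y - y')); last first.
    by rewrite !mulrBr ![y * _]mulrC addrA subrK.
  by apply: (idealD II); apply: (idealM II).
- by move=> *; apply: (ideal_eq II); apply: addrA.
- by move=> *; apply: (ideal_eq II); apply: addrC.
- by move=> *; apply: (ideal_eq II); rewrite rmorph0 add0r.
- by move=> *; apply: (ideal_eq II); rewrite rmorph0 addNr.
- by move=> *; apply: (ideal_eq II); apply: mulrA.
- by move=> *; apply: (ideal_eq II); apply: mulrC.
- by move=> *; apply: (ideal_eq II); rewrite rmorph1 mul1r.
- by move=> *; apply: (ideal_eq II); apply: mulrDl.
- by move=> *; apply: (ideal_eq II); apply: rmorphB.
- by move=> *; apply: (ideal_eq II); apply: rmorphM.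
Defined.

Lemma ideal_quotient (A : comPzRingType) (C : algebra A) (I : C -> Prop) :
  ideal I -> exists (Q : algebra A) (q : alg_hom C Q),
    (forall y, exists x, q x = y) /\ (forall x, q x = 0 <-> I x).
Proof.
move=> II; pose W := ideal_weak_algebra II.
have [psurj peq pA pN pD pM] := strict_class_map W.
have [||q qE] := @alg_hom_of A C (strict_algebra W) (@strict_pi A W) _ _ pA.
- by move=> x y; rewrite -pN -pD.
- by split=> [|x y]; [rewrite -(rmorph1 (alg_str C)) pA rmorph1 | rewrite -pM].
exists (strict_algebra W), q; split=> [y|x].
  by have [x <-] := psurj y; exists x; rewrite qE.
rewrite qE -(rmorph0 (alg_str (strict_algebra W))) -pA peq /=.
by rewrite rmorph0 subr0.
Qed.

Inductive term (A X : Type) :=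
  | Const of A
  | Var of X
  | Opp of term A X
  | Add of term A X & term A X
  | Mul of term A X & term A X.

Arguments Const {A X} a.
Arguments Var {A X} x.

Fixpoint eval (A : comPzRingType) (X : Type) (C : algebra A) (v : X -> C)
    (t : term A X) : C :=
  match t with
  | Const a => alg_str C a
  | Var x => v x
  | Opp t => - eval v t
  | Add t u => eval v t + eval v u
  | Mul t u => eval v t * eval v u
  end.

(** Two polynomial terms are identified when they agree under every evaluation
    in every [A]-algebra. The laws of algebras and the extension of
    evaluations to classes are then immediate, also over the zero ring. *)
Definition free_weak_algebra (A : comPzRingType) (X : Type) : weak_algebra A.
Proof.
refine (@WeakAlgebra A (term A X)
  (fun t u => forall (C : algebra A) (v : X -> C), eval v t = eval v u)
  Const (@Opp A X) (@Add A X) (@Mul A X) _ _ _ _ _ _ _ _ _ _ _ _ _ _ _ _)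
  => /=.
- by [].
- by move=> t u tu C v; rewrite tu.
- by move=> t u w tu uw C v; rewrite tu.
- by move=> t t' tt' C v; rewrite tt'.
- by move=> t t' u u' tt' uu' C v; rewrite tt' uu'.
- by move=> t t' u u' tt' uu' C v; rewrite tt' uu'.
- by move=> *; apply: addrA.
- by move=> *; apply: addrC.
- by move=> *; rewrite rmorph0 add0r.
- by move=> *; rewrite rmorph0 addNr.
- by move=> *; apply: mulrA.
- by move=> *; apply: mulrC.
- by move=> *; rewrite rmorph1 mul1r.
- by move=> *; apply: mulrDl.
- by move=> *; apply: rmorphB.
- by move=> *; apply: rmorphM.
Defined.

Definition free_alg (A : comPzRingType) (X : Type) : algebra A :=
  strict_algebra (free_weak_algebra A X).

Definition free_var (A : comPzRingType) (X : Type) (x : X) : free_alg A X :=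
  @strict_pi A (free_weak_algebra A X) (Var x).

(** Every class contains a term, and terms are built from constants and
    variables; this gives uniqueness in the universal property. *)
Lemma free_alg_ind (A : comPzRingType) (X : Type) (S : free_alg A X -> Prop) :
    (forall a, S (alg_str (free_alg A X) a)) -> (forall x, S (free_var A x)) ->
    (forall p, S p -> S (- p)) -> (forall p q, S p -> S q -> S (p + q)) ->
    (forall p q, S p -> S q -> S (p * q)) ->
  forall p, S p.
Proof.
have [psurj peq pA pN pD pM] := strict_class_map (free_weak_algebra A X).
move=> SA SV SN SD SM p; have [t <-] := psurj p.
elim: t => [a|x|t St|t St u Su|t St u Su].
- by rewrite (pA a); apply: SA.
- exact: SV.
- by rewrite (pN t); apply: SN.
- by rewrite (pD t u); apply: SD.
- by rewrite (pM t u); apply: SM.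
Qed.

Lemma free_alg_ext (A : comPzRingType) (X : Type) (C : algebra A)
    (f g : alg_hom (free_alg A X) C) :
  (forall x, f (free_var A x) = g (free_var A x)) -> f =1 g.
Proof.
move=> fg; apply: free_alg_ind => //.
- by move=> a; rewrite !alg_funE.
- by move=> p e; rewrite !rmorphN e.
- by move=> p q e e'; rewrite !rmorphD e e'.
- by move=> p q e e'; rewrite !rmorphM e e'.
Qed.

Lemma free_lift_exists (A : comPzRingType) (X : Type) (C : algebra A)
    (v : X -> C) :
  exists f : alg_hom (free_alg A X) C, forall x, f (free_var A x) = v x.
Proof.
have [psurj peq pA pN pD pM] := strict_class_map (free_weak_algebra A X).
have [s ps] := choice psurj.
have ev t : eval v (s (strict_pi (W:=free_weak_algebra A X) t)) = eval v t.
  by have /peq := ps (strict_pi (W:=free_weak_algebra A X) t); apply.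
have [|||f fE] := @alg_hom_of A (free_alg A X) C (eval v \o s).
- move=> p q /=; have [[t <-] [u <-]] := (psurj p, psurj q).
  by rewrite -pN -pD !ev.
- split=> [|p q] /=.
    by rewrite -(rmorph1 (alg_str (free_alg A X))) -pA ev /= rmorph1.
  by have [[t <-] [u <-]] := (psurj p, psurj q); rewrite -pM !ev.
- by move=> a /=; rewrite -pA ev.
by exists f => x; rewrite fE /= ev.
Qed.

Definition free_lift (A : comPzRingType) (X : Type) (C : algebra A)
    (v : X -> C) : alg_hom (free_alg A X) C :=
  sval (cid (free_lift_exists v)).

Lemma free_liftE (A : comPzRingType) (X : Type) (C : algebra A)
  (v : X -> C) x : free_lift v (free_var A x) = v x.
Proof. exact: (svalP (cid (free_lift_exists v))). Qed.

Lemma free_polynomial (A : comPzRingType) (X : finType) :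
  polynomial_algebra (fun i : 'I_#|X| => free_var A (enum_val i)).
Proof.
move=> C b; exists (free_lift (fun x => b (enum_rank x))); split=> [i|g gE].
  by rewrite free_liftE enum_valK.
apply: free_alg_ext => x; rewrite free_liftE.
by rewrite -gE enum_rankK.
Qed.

(** * Points of the factorisation system are fields *)

Lemma fg_ideal_quotient (A : comPzRingType) (C : algebra A) (s : seq C) :
  exists (Q : algebra A) (q : alg_hom C Q),
    fg_quotient (alg_fun q) /\ (forall x, q x = 0 <-> ideal_span s x).
Proof.
have [Q [q [qsurj qs]]] := ideal_quotient (span_ideal s).
by exists Q, q; split=> //; apply/fg_quotientP; split=> //; exists s.
Qed.

(** The quotient of [K] by [x] is either zero, and then [x] is invertible, or
    a retract of [K], and then [x = 0]. *)
Lemma factorisation_point_cancel (K : comPzRingType) (x y : K) :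
  factorisation_point K -> x * y = 0 -> x = 0 \/ y = 0.
Proof.
move=> [_ Kpt] xy; pose KK := @Algebra K K idfun.
have [Q [q [qfg qs]]] := @fg_ideal_quotient K KK [:: x].
have [Q0|Q1] := EM ((1 : Q) = 0).
  (* The annihilator of [y] is an ideal that contains [x], hence [1]. *)
  right; rewrite -[y]mul1r.
  have : q 1 = 0 by rewrite rmorph1.
  move=> /qs; apply: (span_min (I := fun z : K => z * y = 0)).
    split=> [|u v u0 v0|a u u0]; first exact: mul0r.
      by rewrite mulrDl u0 v0 addr0.
    by rewrite -mulrA u0 mulr0.
  by move=> z; rewrite inE => /eqP->.
left; have [r rq] := Kpt Q q qfg Q1.
have /qs qx : ideal_span [:: x] (x : KK) by apply: mem_span; rewrite inE.
by rewrite -(rq x) qx rmorph0.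
Qed.

Lemma field_factorisation_point (K : fieldType) : factorisation_point K.
Proof.
split=> [|Q q [qsurj _] Q1]; first exact/eqP/oner_neq0.
apply: (factor_surjection (f := idfun)) => // x qx.
apply/eqP/negP => /negP x0; apply: Q1.
by rewrite -(rmorph1 q) -(mulVf x0) rmorphM qx mulr0.
Qed.

(** The point is the field of fractions of [B]. *)
Lemma domain_embeds (B : comPzRingType) : integral_domain B ->
  exists (K : comPzRingType) (f : {rmorphism B -> K}),
    factorisation_point K /\ forall x, f x = 0 -> x = 0.
Proof.
case=> /eqP B1 Bdom.
(* A commutative ring has to be given inverses, chosen classically, before it
   can be regarded as an integral domain with a field of fractions. *)
pose BN := HB.pack_for comNzRingType B (GRing.PzSemiRing_isNonZero.Build B B1).
pose u : {pred BN} := fun x => `[< exists y, y * x = 1 >].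
have /choice[i uP] (x : BN) :
    exists y : BN, if x \in u then y * x = 1 else y = x.
  case xu: (x \in u); last by exists x.
  by have /asboolP : `[< exists y : BN, y * x = 1 >] := xu.
have uV : {in u, left_inverse 1 i *%R} by move=> x ux; have := uP x; rewrite ux.
have uPl x y : y * x = 1 -> u x by move=> yx; apply/asboolP; exists y.
have uout : {in [predC u], i =1 id}.
  by move=> x; rewrite inE /= => /negPf xu; have := uP x; rewrite xu.
pose BU := HB.pack_for comUnitRingType BN
  (GRing.ComNzRing_hasMulInverse.Build BN uV uPl uout).
pose BD := HB.pack_for idomainType BU
  (GRing.ComUnitRing_isIntegral.Build BU Bdom).
exists {fraction BD}, (@FracField.tofrac BD : {rmorphism BD -> {fraction BD}}).
split=> [|x /eqP]; first exact: field_factorisation_point.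
by rewrite tofrac_eq0 => /eqP.
Qed.

(** * Filtered colimits and finite presentation *)

(** The transition maps of a pro-object of the opposite category point from
    the target of an arrow to its source; [stage] and [step] retype its
    objects and maps as algebras and algebra maps. *)
Definition stage (A : comPzRingType) (P : proobject (op (Alg A)))
  (i : pro_idx P) : algebra A := P i.

Definition step (A : comPzRingType) (P : proobject (op (Alg A)))
  (i j : pro_idx P) (u : arr i j) : alg_hom (stage j) (stage i) :=
  pro_map P u.

Lemma step_id (A : comPzRingType) (P : proobject (op (Alg A))) (i : pro_idx P)
  (x : stage i) : step (arr_id i) x = x.
Proof. by move: x; apply: (@pro_map_id _ P i). Qed.

Lemma step_comp (A : comPzRingType) (P : proobject (op (Alg A)))
    (i j k : pro_idx P) (v : arr j k) (u : arr i j) (x : stage k) :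
  step (arr_comp v u) x = step u (step v x).
Proof. by move: x; apply: (@pro_map_comp _ P i j k v u). Qed.

(** The elementwise form of a filtered colimit. For maps of algebras it is
    enough to say that an element which vanishes in [L] vanishes at a later
    stage, since the equality of two elements reduces to this after moving
    both to a common stage. *)
Definition is_colim (A : comPzRingType) (P : proobject (op (Alg A)))
    (L : algebra A) (p : forall i : pro_idx P, alg_hom (stage i) L) : Prop :=
  [/\ forall (i j : pro_idx P) (u : arr i j) (x : stage j),
        p i (step u x) = p j x,
      forall y, exists i (x : stage i), p i x = y &
      forall i (x : stage i), p i x = 0 ->
        exists (k : pro_idx P) (u : arr k i), step u x = 0].

Lemma arr_spanT (c : cofiltered) (i j : c) :
  {k : c & (arr k i * arr k j)%type}.
Proof.
have [k /cid[u /cid[v _]]] := cid (arr_span i j).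
by exists k; split.
Qed.

(** In a cofiltered category two spans over the same pair of objects can be
    completed to commuting squares simultaneously; this is what makes equality
    of germs transitive and compatible with binary operations. *)
Lemma arr_square (c : cofiltered) (l l' k k' : c)
    (u : arr l k) (v : arr l k') (u' : arr l' k) (v' : arr l' k') :
  exists n (f : arr n l) (g : arr n l'),
    arr_comp u f = arr_comp u' g /\ arr_comp v f = arr_comp v' g.
Proof.
have [m [f [g _]]] := arr_span l l'.
have [n [e eE]] := arr_equalize (arr_comp u f) (arr_comp u' g).
have [o [d dE]] := arr_equalize
  (arr_comp (arr_comp v f) e) (arr_comp (arr_comp v' g) e).
exists o, (arr_comp f (arr_comp e d)), (arr_comp g (arr_comp e d)).
by split; rewrite !arr_assoc; [rewrite eE | rewrite dE].
Qed.

Section Colimit.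
Variables (A : comPzRingType) (P : proobject (op (Alg A))).

Definition colim_car := {i : pro_idx P & stage i}.

Definition colim_elt (i : pro_idx P) (x : stage i) : colim_car :=
  existT (fun i => alg_ring (stage i)) i x.

Definition colim_eq (a b : colim_car) : Prop :=
  exists (k : pro_idx P) (u : arr k (tag a)) (v : arr k (tag b)),
    step u (tagged a) = step v (tagged b).

Lemma colim_eq_refl a : colim_eq a a.
Proof. by exists (tag a), (arr_id _), (arr_id _). Qed.

Lemma colim_eq_sym a b : colim_eq a b -> colim_eq b a.
Proof. by case=> k [u [v e]]; exists k, v, u. Qed.

Lemma colim_eq_step i j (u : arr i j) (x : stage j) :
  colim_eq (colim_elt x) (colim_elt (step u x)).
Proof. by exists i, u, (arr_id i); rewrite /= step_id. Qed.

Definition natural2 (o : forall i : pro_idx P, stage i -> stage i -> stage i) :=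
  forall i j (u : arr i j) (x y : stage j),
    step u (o j x y) = o i (step u x) (step u y).

Lemma colim_eq_op2 o (i j : pro_idx P) (x y : stage i) (x' y' : stage j) :
    natural2 o -> colim_eq (colim_elt x) (colim_elt x') ->
    colim_eq (colim_elt y) (colim_elt y') ->
  colim_eq (colim_elt (o i x y)) (colim_elt (o j x' y')).
Proof.
move=> onat [k [u [v /= uv]]] [k' [u' [v' /= uv']]].
have [n [f [g [eu ev]]]] := arr_square u v u' v'.
exists n, (arr_comp u f), (arr_comp v f); rewrite /= !onat; congr (o n _ _).
  by rewrite !step_comp uv.
by rewrite eu ev !step_comp uv'.
Qed.

Lemma colim_eq_trans a b c : colim_eq a b -> colim_eq b c -> colim_eq a c.
Proof.
case=> k [u [v uv]] [k' [u' [v' uv']]].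
have [n [f [g [e _]]]] := arr_square v v u' u'.
exists n, (arr_comp u f), (arr_comp v' g).
by rewrite !step_comp uv -uv' -!step_comp e.
Qed.

Definition colim_op2 (o : forall i : pro_idx P, stage i -> stage i -> stage i)
    (a b : colim_car) : colim_car :=
  let s := arr_spanT (tag a) (tag b) in
  colim_elt (o (tag s) (step (tagged s).1 (tagged a))
                       (step (tagged s).2 (tagged b))).

(** An operation on germs may be computed with representatives at any stage, not
    just the chosen one. All the laws of the colimit follow by moving the
    elements involved to one stage. *)
Lemma colim_op2E o a b i (x y : stage i) :
    natural2 o -> colim_eq a (colim_elt x) -> colim_eq b (colim_elt y) ->
  colim_eq (colim_op2 o a b) (colim_elt (o i x y)).
Proof.
move=> onat ax bx; rewrite /colim_op2; case: arr_spanT => k [u v] /=.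
apply: colim_eq_op2 => //.
  apply: colim_eq_trans ax; apply: colim_eq_sym.
  by case: a u => ? ? u; apply: colim_eq_step.
apply: colim_eq_trans bx; apply: colim_eq_sym.
by case: b v => ? ? v; apply: colim_eq_step.
Qed.

Lemma colim_common (a b c : colim_car) : exists i (x y z : stage i),
  [/\ colim_eq a (colim_elt x), colim_eq b (colim_elt y) &
      colim_eq c (colim_elt z)].
Proof.
case: a b c => [i x] [j y] [k z].
have [l [u [v _]]] := arr_span i j; have [m [s [t _]]] := arr_span l k.
exists m, (step (arr_comp u s) x), (step (arr_comp v s) y), (step t z).
by split; apply: colim_eq_step.
Qed.

Lemma add_natural : natural2 (fun i => +%R).
Proof. by move=> *; apply: rmorphD. Qed.

Lemma mul_natural : natural2 (fun i => *%R).
Proof. by move=> *; apply: rmorphM. Qed.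

Lemma colim_const i j (a : A) :
  colim_eq (colim_elt (alg_str (stage i) a)) (colim_elt (alg_str (stage j) a)).
Proof.
have [k [u [v _]]] := arr_span i j.
by exists k, u, v; rewrite /= !alg_funE.
Qed.

Lemma colim_opp a i (x : stage i) :
  colim_eq a (colim_elt x) ->
  colim_eq (colim_elt (- tagged a)) (colim_elt (- x)).
Proof.
by case=> k [u [v /= uv]]; exists k, u, v; rewrite /= !rmorphN uv.
Qed.

Definition colim_add := colim_op2 (fun i => +%R).
Definition colim_mul := colim_op2 (fun i => *%R).

Lemma colim_addE a b i (x y : stage i) :
    colim_eq a (colim_elt x) -> colim_eq b (colim_elt y) ->
  colim_eq (colim_add a b) (colim_elt (x + y)).
Proof. exact: (colim_op2E (o := fun i => +%R) add_natural). Qed.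

Lemma colim_mulE a b i (x y : stage i) :
    colim_eq a (colim_elt x) -> colim_eq b (colim_elt y) ->
  colim_eq (colim_mul a b) (colim_elt (x * y)).
Proof. exact: (colim_op2E (o := fun i => *%R) mul_natural). Qed.

Lemma colim_eq_via a b i (x y : stage i) :
  colim_eq a (colim_elt x) -> colim_eq b (colim_elt y) -> x = y -> colim_eq a b.
Proof.
by move=> ax + xy; rewrite -xy => /colim_eq_sym; apply: colim_eq_trans.
Qed.

Definition colim_weak_algebra (i0 : pro_idx P) : weak_algebra A.
Proof.
refine (@WeakAlgebra A colim_car colim_eq
  (fun a => colim_elt (alg_str (stage i0) a))
  (fun a => colim_elt (- tagged a)) colim_add colim_mul
  colim_eq_refl colim_eq_sym colim_eq_trans _ _ _ _ _ _ _ _ _ _ _ _ _).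
- move=> a b ab; have [i [x [_ [_ [ax _ _]]]]] := colim_common a a a.
  apply: (colim_eq_via (colim_opp ax)) (colim_opp _) erefl.
  exact: colim_eq_trans (colim_eq_sym ab) ax.
- move=> a a' b b' aa' bb'.
  have [i [x [y [_ [ax bx _]]]]] := colim_common a b b.
  apply: (colim_eq_via (colim_addE ax bx)) (colim_addE _ _) erefl.
    exact: colim_eq_trans (colim_eq_sym aa') ax.
  exact: colim_eq_trans (colim_eq_sym bb') bx.
- move=> a a' b b' aa' bb'.
  have [i [x [y [_ [ax bx _]]]]] := colim_common a b b.
  apply: (colim_eq_via (colim_mulE ax bx)) (colim_mulE _ _) erefl.
    exact: colim_eq_trans (colim_eq_sym aa') ax.
  exact: colim_eq_trans (colim_eq_sym bb') bx.
- move=> a b c; have [i [x [y [z [ax bx cx]]]]] := colim_common a b c.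
  apply: (colim_eq_via (colim_addE ax (colim_addE bx cx))) (addrA _ _ _).
  exact: colim_addE (colim_addE ax bx) cx.
- move=> a b; have [i [x [y [_ [ax bx _]]]]] := colim_common a b b.
  exact: colim_eq_via (colim_addE ax bx) (colim_addE bx ax) (addrC _ _).
- move=> a; have [i [x [_ [_ [ax _ _]]]]] := colim_common a a a.
  apply: colim_eq_via (colim_addE (colim_const i0 i 0) ax) ax _.
  by rewrite rmorph0 add0r.
- move=> a; have [i [x [_ [_ [ax _ _]]]]] := colim_common a a a.
  apply: colim_eq_via (colim_addE (colim_opp ax) ax) (colim_const i0 i 0) _.
  by rewrite rmorph0 addNr.
- move=> a b c; have [i [x [y [z [ax bx cx]]]]] := colim_common a b c.
  apply: (colim_eq_via (colim_mulE ax (colim_mulE bx cx))) (mulrA _ _ _).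
  exact: colim_mulE (colim_mulE ax bx) cx.
- move=> a b; have [i [x [y [_ [ax bx _]]]]] := colim_common a b b.
  exact: colim_eq_via (colim_mulE ax bx) (colim_mulE bx ax) (mulrC _ _).
- move=> a; have [i [x [_ [_ [ax _ _]]]]] := colim_common a a a.
  apply: colim_eq_via (colim_mulE (colim_const i0 i 1) ax) ax _.
  by rewrite rmorph1 mul1r.
- move=> a b c; have [i [x [y [z [ax bx cx]]]]] := colim_common a b c.
  apply: (colim_eq_via (colim_mulE (colim_addE ax bx) cx)) (mulrDl _ _ _).
  exact: colim_addE (colim_mulE ax cx) (colim_mulE bx cx).
- move=> a b; apply: colim_eq_via (colim_eq_refl _) _ (rmorphB _ _ _).
  have e c := colim_const i0 i0 c.
  exact: colim_addE (e a) (colim_opp (e b)).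
- move=> a b; apply: colim_eq_via (colim_eq_refl _) _ (rmorphM _ _ _).
  have e c := colim_const i0 i0 c.
  exact: colim_mulE (e a) (e b).
Defined.

Lemma colim_exists :
  exists (L : algebra A) (p : forall i : pro_idx P, alg_hom (stage i) L),
    is_colim p.
Proof.
have [i0 _] := arr_inhabited (pro_idx P); pose W := colim_weak_algebra i0.
have [psurj peq pA pN pD pM] := strict_class_map W.
pose pi i (x : stage i) : strict_algebra W := @strict_pi A W (colim_elt x).
have piE i j (x : stage i) (y : stage j) :
  pi i x = pi j y <-> colim_eq (colim_elt x) (colim_elt y) by apply: peq.
have piA i a : pi i (alg_str (stage i) a) = alg_str (strict_algebra W) a.
  by rewrite -pA; apply/peq; apply: colim_const.
have piB i : zmod_morphism (pi i).
  move=> x y; rewrite -(pN (colim_elt y)) -pD; apply/peq/colim_eq_sym.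
  exact: colim_addE (colim_eq_refl _) (colim_eq_refl _).
have piM i : monoid_morphism (pi i).
  split=> [|x y]; first by rewrite -(rmorph1 (alg_str (stage i))) piA rmorph1.
  rewrite -pM; apply/peq/colim_eq_sym.
  exact: colim_mulE (colim_eq_refl _) (colim_eq_refl _).
pose p i := sval (cid (alg_hom_of (piB i) (piM i) (piA i))).
have pE i : p i =1 pi i := svalP (cid (alg_hom_of (piB i) (piM i) (piA i))).
exists (strict_algebra W), p; split.
- move=> i j u x; rewrite !pE; apply/piE/colim_eq_sym; exact: colim_eq_step.
- move=> y; have [[i x] <-] := psurj y; exists i, x; exact: pE.
- move=> i x; rewrite -(rmorph0 (p i)) !pE => /piE[k [u [v /= uv]]].
  by exists k, u; rewrite uv rmorph0.
Qed.

End Colimit.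


Lemma colim_sep (A : comPzRingType) (P : proobject (op (Alg A)))
    (L : algebra A) (p : forall i : pro_idx P, alg_hom (stage i) L)
    i j (x : stage i) (y : stage j) :
    is_colim p -> p i x = p j y ->
  exists (k : pro_idx P) (u : arr k i) (v : arr k j), step u x = step v y.
Proof.
case=> pc _ p0 xy; have [l [u [v _]]] := arr_span i j.
have /p0[k [w wE]] : p l (step u x - step v y) = 0.
  by rewrite rmorphB !pc xy subrr.
exists k, (arr_comp u w), (arr_comp v w); rewrite !step_comp.
by apply/eqP; rewrite -subr_eq0 -rmorphB wE.
Qed.

Lemma colim_common_rep (A : comPzRingType) (P : proobject (op (Alg A)))
    (L : algebra A) (p : forall i : pro_idx P, alg_hom (stage i) L) (a b : L) :
  is_colim p -> exists i (x y : stage i), p i x = a /\ p i y = b.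
Proof.
case=> pc psurj _; have [[i [x <-]] [j [y <-]]] := (psurj a, psurj b).
have [k [u [v _]]] := arr_span i j.
by exists k, (step u x), (step v y); rewrite !pc.
Qed.

(** A map out of the colimit sends an element to the image of any
    representative; two representatives agree at a later stage. *)
Lemma colim_limit (A : comPzRingType) (P : proobject (op (Alg A)))
    (L : algebra A) (p : forall i : pro_idx P, alg_hom (stage i) L) :
  is_colim p -> @is_limit (op (Alg A)) P L p.
Proof.
move=> pcol; have [pc psurj _] := pcol; split; first exact: pc.
move=> M /= q qc0.
pose qq (i : pro_idx P) : alg_hom (stage i) M := q i.
have qc i j (u : arr i j) x : qq i (step u x) = qq j x by apply: (qc0 i j u).
have /choice[s sP] y : exists c : {i : pro_idx P & stage i},
    p (tag c) (tagged c) = y.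
  by have [i [x <-]] := psurj y; exists (existT _ i x).
pose f y := qq (tag (s y)) (tagged (s y)).
have fE i x : f (p i x) = qq i x.
  have [k [u [v uv]]] := colim_sep pcol (sP (p i x)).
  by rewrite /f -(qc _ _ u) uv qc.
have [|||g gE] := @alg_hom_of A L M f.
- move=> a b; have [i [x [y [<- <-]]]] := colim_common_rep a b pcol.
  by rewrite -rmorphB !fE rmorphB.
- split=> [|a b].
    have [i _] := arr_inhabited (pro_idx P).
    by rewrite -(rmorph1 (p i)) fE rmorph1.
  have [i [x [y [<- <-]]]] := colim_common_rep a b pcol.
  by rewrite -rmorphM !fE rmorphM.
- move=> a; have [i _] := arr_inhabited (pro_idx P).
  by rewrite -(alg_funE (p i)) fE alg_funE.
exists g; split=> [i x|h hE y]; first by rewrite /= gE fE.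
by have [i [x <-]] := psurj y; rewrite gE fE; apply: hE.
Qed.

Lemma colim_lift (A : comPzRingType) (P : proobject (op (Alg A)))
    (L : algebra A) (p : forall i : pro_idx P, alg_hom (stage i) L)
    n (y : 'I_n -> L) :
  is_colim p -> exists i (x : 'I_n -> stage i), forall m, p i (x m) = y m.
Proof.
move=> [pc psurj _]; elim: n y => [|n IHn] y.
  have [i _] := arr_inhabited (pro_idx P); exists i, (fun=> 0).
  by case.
have [i [x xE]] := IHn (fun m => y (lift ord0 m)).
have [j [z zE]] := psurj (y ord0); have [k [u [v _]]] := arr_span i j.
exists k, (fun m => oapp (fun m => step u (x m)) (step v z) (unlift ord0 m)).
by move=> m; case: unliftP => [m'|] -> /=; rewrite pc.
Qed.

Lemma colim_kill (A : comPzRingType) (P : proobject (op (Alg A)))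
    (L : algebra A) (p : forall i : pro_idx P, alg_hom (stage i) L)
    i (s : seq (stage i)) :
    is_colim p -> (forall x, x \in s -> p i x = 0) ->
  exists (k : pro_idx P) (u : arr k i), forall x, x \in s -> step u x = 0.
Proof.
move=> [pc _ p0]; elim: s => [|x s IHs] s0.
  by exists i, (arr_id i).
have [|j [u uE]] := IHs; first by move=> y ys; apply: s0; rewrite inE ys orbT.
have /p0[k [v vE]] : p j (step u x) = 0 by rewrite pc s0 ?inE ?eqxx.
exists k, (arr_comp u v) => y; rewrite step_comp inE.
by case/orP=> [/eqP->|/uE->]; last exact: rmorph0.
Qed.

Lemma polynomial_ext (A : comPzRingType) n (Q C : algebra A) (x : 'I_n -> Q)
    (f g : alg_hom Q C) :
  polynomial_algebra x -> (forall m, f (x m) = g (x m)) -> f =1 g.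
Proof.
move=> Qpol fg y; have [e [_ eU]] := Qpol C (fun m => g (x m)).
by rewrite (eU f fg) (eU g).
Qed.

(** Lift the images of the finitely many generators to one stage, which
    defines a map on the polynomial algebra; the finitely many relations die
    in [L], hence at a later stage, and there the map descends to [C]. *)
Lemma fp_lift (A : comPzRingType) (P : proobject (op (Alg A)))
    (L : algebra A) (p : forall i : pro_idx P, alg_hom (stage i) L)
    (C : algebra A) (f : alg_hom C L) :
    is_colim p -> finitely_presented C ->
  exists i (h : alg_hom C (stage i)), forall x, p i (h x) = f x.
Proof.
move=> pcol [n [Q [x [q [Qpol /fg_quotientP[qsurj [s qs]]]]]]].
have [pc _ _] := pcol.
have [i [y yE]] := colim_lift (fun m => f (q (x m))) pcol.
have [g [gx _]] := Qpol (stage i) y.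
have gE z : p i (g z) = f (q z).
  move: z; apply: (polynomial_ext Qpol (f := alg_comp (p i) g)
    (g := alg_comp f q)) => m /=.
  by rewrite gx.
have [|k [u uE]] := @colim_kill A P L p i (map g s) pcol.
  by move=> _ /mapP[z zs ->]; rewrite gE (qs z).2 ?rmorph0 //; apply: mem_span.
pose ug := alg_comp (step u) g.
have [z qz|h hE] := factor_alg_surjection (q := q) (f := ug) qsurj.
  apply: (span_min (ideal_kernel (alg_fun ug))) ((qs z).1 qz).
  by move=> w ws /=; apply: uE; apply: map_f.
exists k, h => z; have [w <-] := qsurj z.
by rewrite hE /= pc gE.
Qed.

(** It suffices to equalise the two maps on finitely many generators. *)
Lemma fp_sep (A : comPzRingType) (P : proobject (op (Alg A)))
    (L : algebra A) (p : forall i : pro_idx P, alg_hom (stage i) L)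
    (C : algebra A) i j (f : alg_hom C (stage i)) (g : alg_hom C (stage j)) :
    is_colim p -> finitely_presented C -> (forall x, p i (f x) = p j (g x)) ->
  exists (k : pro_idx P) (u : arr k i) (v : arr k j),
    forall x, step u (f x) = step v (g x).
Proof.
move=> pcol [n [Q [x [q [Qpol [qsurj _]]]]]] fg; have [pc _ _] := pcol.
have [l [u [v _]]] := arr_span i j.
have [|k [w wE]] := @colim_kill A P L p l
    (codom (fun m => step u (f (q (x m))) - step v (g (q (x m))))) pcol.
  by move=> _ /codomP[m ->]; rewrite rmorphB !pc fg subrr.
exists k, (arr_comp u w), (arr_comp v w) => y; have [z <-] := qsurj y.
rewrite !step_comp; move: z.
apply: (polynomial_ext Qpol
  (f := alg_comp (alg_comp (alg_comp (step w) (step u)) f) q)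
  (g := alg_comp (alg_comp (alg_comp (step w) (step v)) g) q)).
move=> m; apply/eqP; rewrite -subr_eq0 /= -rmorphB; apply/eqP/wE.
exact: (codom_f (fun m => step u (f (q (x m))) - step v (g (q (x m))))).
Qed.

(** * Equivalences, and points of a topos of sheaves on a site *)

Lemma heq_compl (C : category) (X Y Z : C) (g : hom Y Z) (f f' : hom X Y) :
  f =m f' -> g \c f =m g \c f'.
Proof. exact: heq_comp (heq_refl g). Qed.

Lemma heq_compr (C : category) (X Y Z : C) (g g' : hom Y Z) (f : hom X Y) :
  g =m g' -> g \c f =m g' \c f.
Proof. by move=> gg'; apply: heq_comp gg' (heq_refl f). Qed.

Lemma cancel_left (C : category) (X Y Z : C) (f : hom X Y) (g : hom Y Z)
    (h : hom Z Y) :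
  h \c g =m idm Y -> h \c (g \c f) =m f.
Proof.
move=> hg; apply: heq_trans (comp_assoc _ _ _) _.
by apply: heq_trans (heq_compr _ hg) (comp_idl _).
Qed.

(** The quasi-inverse picks a preimage of each object up to isomorphism and
    the preimage of each conjugated morphism; faithfulness makes this a
    functor. *)
Lemma fully_faithful_equivalence (C D : category) (F : functor C D) :
    (forall X Y (g : hom (F X) (F Y)), exists f : hom X Y, fmap F f =m g) ->
    (forall X Y (f f' : hom X Y), fmap F f =m fmap F f' -> f =m f') ->
    (forall Y, exists X (e : hom (F X) Y), is_iso e) ->
  is_equivalence F.
Proof.
move=> Ffull Ffaith Fes.
pose ff X Y (g : hom (F X) (F Y)) : hom X Y := sval (cid (Ffull X Y g)).
have ffE X Y (g : hom (F X) (F Y)) : fmap F (ff X Y g) =m g.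
  exact: svalP (cid (Ffull X Y g)).
pose G0 Y : C := sval (cid (Fes Y)).
pose e Y : hom (F (G0 Y)) Y := sval (cid (svalP (cid (Fes Y)))).
have eiso Y : is_iso (e Y) := svalP (cid (svalP (cid (Fes Y)))).
pose e' Y : hom Y (F (G0 Y)) := sval (cid (eiso Y)).
have e'e Y : e' Y \c e Y =m idm _ := proj1 (svalP (cid (eiso Y))).
have ee' Y : e Y \c e' Y =m idm _ := proj2 (svalP (cid (eiso Y))).
pose G1 X Y (f : hom X Y) : hom (G0 X) (G0 Y) := ff _ _ (e' Y \c (f \c e X)).
have G1E X Y (f : hom X Y) : fmap F (G1 X Y f) =m e' Y \c (f \c e X).
  exact: ffE.
have eG X Y (f : hom X Y) : e Y \c fmap F (G1 X Y f) =m f \c e X.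
  exact: heq_trans (heq_compl _ (G1E _ _ f)) (cancel_left _ (ee' Y)).
have G1_heq X Y (f f' : hom X Y) : f =m f' -> G1 X Y f =m G1 X Y f'.
  move=> ff'; apply: Ffaith; apply: heq_trans (G1E _ _ f) _.
  apply: heq_trans (heq_sym (G1E _ _ f')); apply: heq_compl.
  exact: heq_compr.
have G1_id X : G1 X X (idm X) =m idm (G0 X).
  apply: Ffaith; apply: heq_trans (G1E _ _ _) _.
  apply: heq_trans (heq_compl _ (comp_idl _)) _.
  by apply: heq_trans (e'e X) _; apply: heq_sym; apply: fmap_id.
have G1_comp X Y Z (g : hom Y Z) (f : hom X Y) :
    G1 X Z (g \c f) =m G1 Y Z g \c G1 X Y f.
  apply: Ffaith; apply: heq_trans (G1E _ _ _) _; apply: heq_sym.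
  apply: heq_trans (fmap_comp _ _ _) _.
  apply: heq_trans (heq_compl _ (G1E _ _ f)) _.
  apply: heq_trans (heq_compr _ (G1E _ _ g)) _.
  apply: heq_trans (heq_sym (comp_assoc _ _ _)) _; apply: heq_compl.
  apply: heq_trans (heq_sym (comp_assoc _ _ _)) _.
  apply: heq_trans (comp_assoc _ _ _); apply: heq_compl.
  exact: cancel_left (ee' Y).
exists (Functor G1_heq G1_id G1_comp); split.
- exists (fun X => ff (G0 (F X)) X (e (F X))); split=> [X|X Y f].
    exists (ff X (G0 (F X)) (e' (F X))); split; apply: Ffaith.
      apply: heq_trans (fmap_comp _ _ _) _.
      apply: heq_trans (heq_comp (ffE _ _ _) (ffE _ _ _)) _.
      by apply: heq_trans (e'e _) _; apply: heq_sym; apply: fmap_id.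
    apply: heq_trans (fmap_comp _ _ _) _.
    apply: heq_trans (heq_comp (ffE _ _ _) (ffE _ _ _)) _.
    by apply: heq_trans (ee' _) _; apply: heq_sym; apply: fmap_id.
  apply: Ffaith; apply: heq_trans (fmap_comp _ _ _) _.
  apply: heq_trans (heq_compr _ (ffE _ _ _)) _.
  apply: heq_trans (eG _ _ _) _; apply: heq_sym.
  apply: heq_trans (fmap_comp _ _ _) _.
  exact: heq_compl (ffE _ _ _).
- exists e; split=> [Y|X Y f]; first exact: eiso.
  exact: eG.
Qed.

(** The lifting property of a pro-object, extended from families to arbitrary
    sieves and expressed through representatives of its morphisms. *)
Definition stage_lifts (D : category) (P : proobject D) (X : D)
    (S : sieve X) : Prop :=
  forall i (f : hom (P i) X), exists (k : pro_idx P) (u : arr k i),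
    in_sieve S (f \c pro_map P u).

(** For stability under pullback: if the composite of [h] with a refinement of
    [f] is in [S], then that refinement is in the pullback of [S] along [h]. *)
Lemma stage_lifts_topology (D : category) (P : proobject D) :
  grothendieck_topology (@stage_lifts D P).
Proof.
split=> [X S Sall i f|X Y h S SP i f|X S R SP SR i f].
- by exists i, (arr_id i); apply: Sall.
- have [k [u Su]] := SP i (h \c f); exists k, u.
  exact: (@sieve_heq _ _ S) (heq_sym (comp_assoc _ _ _)) Su.
- have [k [u Su]] := SP i f.
  have [l [v Rv]] := SR _ _ Su k (idm (P k)).
  exists l, (arr_comp u v); apply: (@sieve_heq _ _ R) Rv.
  apply: heq_trans (heq_sym (comp_assoc _ _ _)) _; apply: heq_compl.
  apply: heq_trans (heq_sym (pro_map_comp u v)).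
  by apply: heq_compl; apply: comp_idl.
Qed.

Definition germ (D : category) (P : proobject D) (X : D) i
  (f : hom (P i) X) : prohom P (pro_const_obj X).
Proof.
refine (@Prohom D P (pro_const_obj X) (fun _ => i) (fun _ => f) _).
by move=> k l v; apply: germ_eq_heq; apply: comp_idl.
Defined.

Lemma lifts_throughP (D : category) (P : proobject D) (X : D) (F : family X) :
  @lifts_through D P X F <-> stage_lifts P (generated_sieve F).
Proof.
split=> [FP i f|FP f].
  have [j [g /(_ tt)[k [a [b e]]]]] := FP (germ f).
  exists k, b; exists j, (pro_rep g tt \c pro_map P a).
  exact: heq_trans (comp_assoc _ _ _) e.
have [k [u [j [g e]]]] := FP _ (pro_rep f tt).
exists j, (germ g) => -[]; exists k, (arr_id k), u.
apply: heq_trans e.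
by apply: heq_trans (heq_compl _ (pro_map_id k)) (comp_idr _).
Qed.

(** By minimality of the generated topology, lifting may be tested on the
    generating families. *)
Lemma topos_pointP (D : category) (K : coverage D) (P : Pro D) :
  is_topos_point K P <->
  forall (X : D) (F : family X), K X F ->
    stage_lifts (P : proobject D) (generated_sieve F).
Proof.
split=> [Ppt X F KF|PK X F FK]; apply/lifts_throughP.
  by apply: Ppt => J _; apply.
by apply: (FK (@stage_lifts D P)) PK; apply: stage_lifts_topology.
Qed.

(** * Topos points and domains *)

Definition quotient_closed (A : comPzRingType) (T : Alg A -> Prop) : Prop :=
  forall (C D : algebra A) (q : alg_hom C D),
    fg_quotient (alg_fun q) -> T C -> T D.

Definition algs (A : comPzRingType) (T : Alg A -> Prop)
    (P : proobject (opposite_site T)) : proobject (op (Alg A)) :=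
  pro_image (op_inclusion T) P.

(** Apply the lifting property to the identity map of a stage, for the empty
    family when the stage is zero, and for the quotients by [a] and by [b]
    when [a * b = 0] there. *)
Lemma topos_point_domain (A : comPzRingType) (T : Alg A -> Prop)
    (P : Pro (opposite_site T)) (L : algebra A)
    (p : forall i : pro_idx (algs P), alg_hom (stage i) L) :
    quotient_closed T -> is_colim p -> is_topos_point (@point_covering A T) P ->
  integral_domain L.
Proof.
move=> Tq pcol /topos_pointP Ppt; have [pc psurj p0] := pcol; split=> [L0|x y].
  have [i _] := arr_inhabited (pro_idx P).
  have [|k [u u1]] := p0 i 1; first by rewrite rmorph1.
  rewrite rmorph1 in u1.
  pose F : @family (opposite_site T) (@pro_obj _ P k) :=
    @Family (opposite_site T) _ void (fun v => match v with end)
      (fun v => match v with end).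
  have FK : point_covering F.
    split=> [[]|K f [K1 _]]; case: K1.
    by rewrite -(rmorph1 f) -(rmorph0 f); congr (f _).
  by have [l [v [[]]]] := Ppt _ F FK k (idm (@pro_obj _ P k)).
have [i [a [b [<- <-]]]] := colim_common_rep x y pcol.
rewrite -rmorphM => /p0[k [u]]; rewrite rmorphM.
move: (step u a) (step u b) (pc _ _ u a) (pc _ _ u b) => {}a {}b <- <- ab.
pose z (c : bool) := if c then a else b.
have Qex c := fg_ideal_quotient [:: z c].
pose Q c := sval (cid (Qex c)).
pose q c : alg_hom (stage k) (Q c) := sval (cid (svalP (cid (Qex c)))).
have qfg c : fg_quotient (alg_fun (q c)).
  exact: (svalP (cid (svalP (cid (Qex c))))).1.
have qE c w : q c w = 0 <-> ideal_span [:: z c] w.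
  exact: (svalP (cid (svalP (cid (Qex c))))).2.
have TQ c : T (Q c) by apply: Tq (qfg c) (svalP (@pro_obj _ P k)).
pose F : @family (opposite_site T) (@pro_obj _ P k) :=
  @Family (opposite_site T) (@pro_obj _ P k) bool
    (fun c => exist T (Q c) (TQ c)) q.
have FK : point_covering F.
  split=> // K f Kpt.
  have [c fc] : exists c, f (z c) = 0.
    have /(factorisation_point_cancel Kpt) : f a * f b = 0.
      by rewrite -rmorphM ab rmorph0.
    by case; [exists true | exists false].
  exists c; have [] := @factor_surjection _ _ _ (alg_fun (q c)) f (qfg c).1.
    move=> w /(qE c); apply: span_min (ideal_kernel f) _ => v.
    by rewrite inE => /eqP->.
  by move=> g gE; exists g => w; rewrite gE.
have [l [v [c [g gE]]]] := Ppt _ F FK k (idm (@pro_obj _ P k)).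
have zv : @step A (algs P) l k v (z c) = 0.
  pose h : alg_hom (Q c) (@stage A (algs P) l) := g.
  have <- : h (q c (z c)) = @step A (algs P) l k v (z c) := gE (z c).
  by rewrite (qE c _).2 ?rmorph0 //; apply: mem_span; rewrite inE.
have : p k (z c) = 0 by rewrite -(pc _ _ v) zv rmorph0.
by case: c {g gE zv} => /= ->; rewrite eqxx ?orbT.
Qed.

(** The covering condition is applied to the embedding of [L] in its field of
    fractions; injectivity brings the vanishing of the generators of the
    kernel back to [L], and the colimit brings it to a stage. *)
Lemma domain_topos_point (A : comPzRingType) (T : Alg A -> Prop)
    (P : Pro (opposite_site T)) (L : algebra A)
    (p : forall i : pro_idx (algs P), alg_hom (stage i) L) :
    is_colim p -> integral_domain L ->
  is_topos_point (@point_covering A T) P.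
Proof.
move=> pcol Ldom; apply/topos_pointP => X F [Ffg FK] i f0.
have [K [e [Kpt e0]]] := domain_embeds Ldom.
pose f : alg_hom (sval X) (@stage A (algs P) i) := f0.
have [j [g gE]] := FK K (e \o alg_fun (p i) \o alg_fun f) Kpt.
pose q : alg_hom (sval X) (sval (fam_src F j)) := fam_map F j.
have /fg_quotientP[qsurj [s qs]] : fg_quotient (alg_fun q) := Ffg j.
have [|k [u uE]] := @colim_kill A (algs P) L p i (map f s) pcol.
  move=> _ /mapP[y ys ->]; apply: e0.
  rewrite -[LHS]/((e \o alg_fun (p i) \o alg_fun f) y) gE.
  rewrite [alg_fun _ _](_ : _ = 0) ?rmorph0 //.
  by apply/(qs y); apply: mem_span.
have [|h hE] := factor_alg_surjection (q := q) (f := alg_comp (step u) f) qsurj.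
  move=> y /(qs y).
  apply: (span_min (ideal_kernel (alg_fun (alg_comp (step u) f)))) => w ws.
  by apply: uE; apply: map_f.
by exists k, u; exists j, h => y; apply: hE.
Qed.

(** * The functor from topos points to algebras *)

Lemma colim_ext (A : comPzRingType) (P : proobject (op (Alg A)))
    (L M : algebra A) (p : forall i : pro_idx P, alg_hom (stage i) L)
    (f g : alg_hom L M) :
  is_colim p -> (forall i x, f (p i x) = g (p i x)) -> f =1 g.
Proof. by case=> _ psurj _ fg y; have [i [x <-]] := psurj y. Qed.

Lemma colim_desc (A : comPzRingType) (P : proobject (op (Alg A)))
    (L M : algebra A) (p : forall i : pro_idx P, alg_hom (stage i) L)
    (q : forall i : pro_idx P, alg_hom (stage i) M) :
    is_colim p ->
    (forall (i j : pro_idx P) (u : arr i j) x, q i (step u x) = q j x) ->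
  exists g : alg_hom L M, forall i x, g (p i x) = q i x.
Proof.
by move=> /colim_limit[_ Lp] /Lp[g [gq _]]; exists g => i; apply: gq.
Qed.

Lemma colim_iso (A : comPzRingType) (P : proobject (op (Alg A)))
    (L M : algebra A) (p : forall i : pro_idx P, alg_hom (stage i) L)
    (q : forall i : pro_idx P, alg_hom (stage i) M) :
    is_colim p -> is_colim q ->
  exists (f : alg_hom L M) (g : alg_hom M L), cancel f g /\ cancel g f.
Proof.
move=> pcol qcol; have [pc _ _] := pcol; have [qc _ _] := qcol.
have [f fE] := colim_desc pcol qc; have [g gE] := colim_desc qcol pc.
exists f, g; split.
  by apply: (colim_ext (f := alg_comp g f) (g := alg_id L) pcol) => i x;
    rewrite /= fE gE.
by apply: (colim_ext (f := alg_comp f g) (g := alg_id M) qcol) => i x;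
  rewrite /= gE fE.
Qed.

Section Points.
Variables (A : comPzRingType) (T : Alg A -> Prop).

Definition rep (P Q : proobject (opposite_site T)) (f : prohom P Q)
    (k : pro_idx Q) :
  alg_hom (@stage A (algs Q) k) (@stage A (algs P) (pro_src f k)) :=
  pro_rep f k.

Lemma rep_comp (P Q R : proobject (opposite_site T)) (g : prohom Q R)
    (f : prohom P Q) (k : pro_idx R) :
  rep (prohom_comp g f) k = alg_comp (rep f (pro_src g k)) (rep g k).
Proof. by cbn. Qed.

Lemma germ_eqE (P : proobject (opposite_site T)) (L : algebra A)
    (p : forall i : pro_idx (algs P), alg_hom (stage i) L)
    (X : opposite_site T) (i j : pro_idx P)
    (f : alg_hom (sval X) (@stage A (algs P) i))
    (g : alg_hom (sval X) (@stage A (algs P) j)) :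
    is_colim p ->
  @germ_eq (opposite_site T) P X i j f g -> forall x, p i (f x) = p j (g x).
Proof.
case=> pc _ _ [k [u [v uv]]] x.
rewrite -(pc k i u) -(pc k j v); congr (p k _); exact: uv.
Qed.

Lemma germ_eqI (P : proobject (opposite_site T)) (L : algebra A)
    (p : forall i : pro_idx (algs P), alg_hom (stage i) L)
    (X : opposite_site T) (i j : pro_idx P)
    (f : alg_hom (sval X) (@stage A (algs P) i))
    (g : alg_hom (sval X) (@stage A (algs P) j)) :
    is_colim p -> finitely_presented (sval X) ->
    (forall x, p i (f x) = p j (g x)) ->
  @germ_eq (opposite_site T) P X i j f g.
Proof.
by move=> pcol Xfp /(fp_sep pcol Xfp)[k [u [v uv]]]; exists k, u, v.
Qed.

Lemma colim_prohom (P Q : proobject (opposite_site T)) (L M : algebra A)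
    (p : forall i : pro_idx (algs P), alg_hom (stage i) L)
    (q : forall i : pro_idx (algs Q), alg_hom (stage i) M) (f : prohom P Q) :
    is_colim p -> is_colim q ->
  exists g : alg_hom M L,
    forall k x, g (q k x) = p (pro_src f k) (rep f k x).
Proof.
move=> pcol qcol.
pose r k := alg_comp (p (pro_src f k)) (rep f k).
have [i j u x|g gE] := @colim_desc A (algs Q) M L q r qcol; last by exists g.
exact: (germ_eqE pcol (pro_compat f u)).
Qed.

Lemma prohom_lift (P Q : proobject (opposite_site T)) (L M : algebra A)
    (p : forall i : pro_idx (algs P), alg_hom (stage i) L)
    (q : forall i : pro_idx (algs Q), alg_hom (stage i) M) (g : alg_hom M L) :
    (forall C, T C -> finitely_presented C) -> is_colim p -> is_colim q ->
  exists f : prohom P Q,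
    forall k x, g (q k x) = p (pro_src f k) (rep f k x).
Proof.
move=> Tfp pcol qcol; have [qc _ _] := qcol.
have lift (k : pro_idx (algs Q)) := fp_lift (alg_comp g (q k)) pcol
  (Tfp _ (svalP (@pro_obj _ Q k))).
pose s k := sval (cid (lift k)).
pose r k : alg_hom (stage k) (stage (s k)) := sval (cid (svalP (cid (lift k)))).
have rE k x : p (s k) (r k x) = g (q k x).
  exact: (svalP (cid (svalP (cid (lift k))))).
have rc (k l : pro_idx Q) (v : arr k l) :
    @germ_eq (opposite_site T) P _ _ _ (pro_map Q v \c r k) (r l).
  apply: (germ_eqI pcol (Tfp _ (svalP (@pro_obj _ Q l)))) => x.
  rewrite -[LHS]/(p (s k) (r k (@step A (algs Q) k l v x))).
  by rewrite !rE qc.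
by exists (Prohom rc) => k x; rewrite -rE.
Qed.

(** The functor sends a topos point to a chosen colimit. It is fully faithful
    because the objects of [T] are compact, and the hypotheses on [V] say that
    [V] is the class of domains that are colimits of diagrams in [T]. *)
Lemma points_as_colimits (V : Alg A -> Prop) :
    (forall C, T C -> finitely_presented C) -> quotient_closed T ->
    (forall (P : proobject (opposite_site T)) (L : algebra A)
        (p : forall i : pro_idx (algs P), alg_hom (stage i) L),
      is_colim p -> integral_domain L -> V L) ->
    (forall B : algebra A, V B -> integral_domain B /\
      exists (P : proobject (opposite_site T))
        (p : forall i : pro_idx (algs P), alg_hom (stage i) B), is_colim p) ->
  exists F : functor (topos_points (@point_covering A T)) (op (full V)),
    is_equivalence F /\
    computes_limits (op_inclusion T) (functor_comp (op_inclusion V) F).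
Proof.
move=> Tfp Tq Vcolim colimV.
pose pts := topos_points (@point_covering A T).
have [L [p pcol]] : exists (L : pts -> algebra A)
    (p : forall (P : pts) (i : pro_idx (algs (sval P))),
      alg_hom (stage i) (L P)),
    forall P, is_colim (p P).
  pose Lp (P : pts) := cid (colim_exists (algs (sval P))).
  exists (fun P => sval (Lp P)), (fun P => sval (cid (svalP (Lp P)))) => P.
  exact: svalP (cid (svalP (Lp P))).
have VL P : V (L P).
  by apply: Vcolim (pcol P) _; apply: topos_point_domain Tq (pcol P) (svalP P).
pose F0 P : op (full V) := exist V (L P) (VL P).
have [F1 F1E] : exists F1 : forall P Q : pts, hom P Q -> alg_hom (L Q) (L P),
    forall (P Q : pts) (f : @prohom (opposite_site T) (sval P) (sval Q)) k x,
      F1 P Q f (p Q k x) = p P (pro_src f k) (rep f k x).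
  pose F1ex (P Q : pts) f := cid (colim_prohom f (pcol P) (pcol Q)).
  exists (fun P Q f => sval (F1ex P Q f)) => P Q f; exact: svalP (F1ex P Q f).
have F1_heq (P Q : pts) (f f' : hom P Q) : f =m f' -> F1 P Q f =1 F1 P Q f'.
  move=> ff'; apply: (colim_ext (pcol Q)) => k x; rewrite !F1E.
  exact: (germ_eqE (pcol P) (ff' k)).
have F1_id (P : pts) : F1 P P (idm P) =1 id.
  apply: (colim_ext (g := alg_id (L P)) (pcol P)) => k x.
  exact: (F1E P P (idm P)).
have F1_comp (P Q R : pts) (g : hom Q R) (f : hom P Q) :
    F1 P R (g \c f) =1 F1 P Q f \o F1 Q R g.
  apply: (colim_ext (g := alg_comp (F1 P Q f) (F1 Q R g)) (pcol R)) => k x.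
  rewrite /= [RHS](congr1 (F1 P Q f) (F1E Q R g k x)).
  rewrite [RHS](F1E P Q f (pro_src g k) (rep g k x)).
  by rewrite (F1E P R (prohom_comp g f)) rep_comp.
exists (@Functor pts (op (full V)) F0 F1 F1_heq F1_id F1_comp); split.
- apply: fully_faithful_equivalence => [P Q g|P Q f f' ff'|[B VB]].
  + have [f fE] := prohom_lift g Tfp (pcol P) (pcol Q).
    by exists f; apply: (colim_ext (pcol Q)) => k x; rewrite F1E fE.
  + move=> k.
    apply: (germ_eqI (pcol P) (Tfp _ (svalP (@pro_obj _ (sval Q) k)))) => x.
    by have := ff' (p Q k x); rewrite !F1E.
  + have [Bdom [P [q qcol]]] := colimV B VB.
    pose X : pts := exist _ P (domain_topos_point qcol Bdom).
    have [f [g [fg gf]]] := colim_iso (P := algs P) (pcol X) qcol.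
    by exists X, g, f; split=> x; [apply: fg | apply: gf].
- exists p; split=> [P|P Q f k x]; first exact: colim_limit (pcol P).
  exact: F1E.
Qed.

End Points.

(** * Presentations of an algebra, and the two topoi *)

Section Support.
Variables (A : comPzRingType) (X : Type).
Implicit Types l : seq {classic X}.

Definition free_on l : algebra A := free_alg A (seq_sub l).

Definition incl l : alg_hom (free_on l) (free_alg A X) :=
  free_lift (fun x : seq_sub l => free_var A (ssval x : X)).

(** A retraction of [incl]: the variables outside [l] are sent to [0]. *)
Definition restr l : alg_hom (free_alg A X) (free_on l) :=
  free_lift (fun x : X =>
    if insub (x : {classic X}) is Some y then free_var A y else 0).

Lemma inclK l : cancel (incl l) (restr l).
Proof.
apply: (free_alg_ext (f := alg_comp (restr l) (incl l)) (g := alg_id _)) => x.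
by rewrite /= !free_liftE valK.
Qed.

Lemma incl_restr l l' p :
  {subset l <= l'} -> incl l' (restr l' (incl l p)) = incl l p.
Proof.
move=> ll'; move: p; apply: (free_alg_ext (g := incl l)
  (f := alg_comp (incl l') (alg_comp (restr l') (incl l)))) => x.
rewrite /= !free_liftE insubT; first by apply: ll'; apply: valP.
by move=> xl'; rewrite free_liftE.
Qed.

Definition supported l (p : free_alg A X) : Prop := incl l (restr l p) = p.

Lemma supported_sub l l' p :
  {subset l <= l'} -> supported l p -> supported l' p.
Proof. by move=> ll' <-; apply: incl_restr. Qed.

Lemma supported_incl l p : supported l (incl l p).
Proof. by rewrite /supported inclK. Qed.

Lemma finite_support p : exists l, supported l p.
Proof.
have cat_l l l' : {subset l <= l ++ l'} by move=> x; rewrite mem_cat => ->.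
have cat_r l l' : {subset l' <= l ++ l'}.
  by move=> x; rewrite mem_cat orbC => ->.
elim/free_alg_ind: p => [a|x|p [l lp]|p q [l lp] [l' lq]|p q [l lp] [l' lq]].
- by exists [::]; rewrite /supported !alg_funE.
- exists [:: x : {classic X}]; rewrite /supported free_liftE.
  by rewrite insubT ?inE // => xl; rewrite free_liftE.
- by exists l; rewrite /supported !rmorphN lp.
- exists (l ++ l'); rewrite /supported !rmorphD.
  by rewrite (supported_sub (cat_l l l') lp) (supported_sub (cat_r l l') lq).
- exists (l ++ l'); rewrite /supported !rmorphM.
  by rewrite (supported_sub (cat_l l l') lp) (supported_sub (cat_r l l') lq).
Qed.

End Support.

Arguments incl {A X} l.
Arguments restr {A X} l.

Section Presentation.
Variables (A : comPzRingType) (X : Type) (B : algebra A) (b : X -> B).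

(** The relations live in the free algebra on all of [X], so that one
    presentation can be compared with another by inclusion of generators and
    of relations. *)
Record presentation := Presentation {
  gens : seq {classic X};
  rels : seq (free_alg A X);
  rels_supported : forall r, r \in rels -> supported gens r;
  rels_kill : forall r, r \in rels -> free_lift b r = 0 }.

Definition finer (i j : presentation) : Prop :=
  {subset gens j <= gens i} /\ {subset rels j <= rels i}.

Lemma finer_refl i : finer i i. Proof. by split. Qed.

Lemma finer_trans i j k : finer j k -> finer i j -> finer i k.
Proof.
move=> [gjk rjk] [gij rij]; split=> x xk.
  exact/gij/gjk.
exact/rij/rjk.
Qed.

Lemma finer_join i j : exists k, finer k i /\ finer k j.
Proof.
have sup r : r \in rels i ++ rels j -> supported (gens i ++ gens j) r.
  rewrite mem_cat => /orP[] /rels_supported; apply: supported_sub => x;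
  by rewrite mem_cat => ->; rewrite ?orbT.
have kill r : r \in rels i ++ rels j -> free_lift b r = 0.
  by rewrite mem_cat => /orP[]; apply: rels_kill.
by exists (Presentation sup kill); split; split=> x; rewrite mem_cat => ->;
  rewrite ?orbT.
Qed.

(** Arrows are proofs of refinement, so this cofiltered category is a directed
    poset. *)
Definition presentations : cofiltered.
Proof.
refine (@Cofiltered presentation finer finer_refl finer_trans _ _ _ _ _ _).
- by move=> *; apply: Prop_irrelevance.
- by move=> *; apply: Prop_irrelevance.
- by move=> *; apply: Prop_irrelevance.
- by unshelve eexists (@Presentation [::] [::] _ _).
- by move=> i j; have [k [ki kj]] := finer_join i j; exists k, ki, kj.
- by move=> i j u v; exists i, (finer_refl i); apply: Prop_irrelevance.
Defined.

Definition presented_quotient (i : presentation) :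
  {Q : algebra A & {q : alg_hom (free_on A (gens i)) Q |
    (forall y, exists x, q x = y) /\
    (forall p, q p = 0 <-> ideal_span (rels i) (incl (gens i) p))}}.
Proof.
have := ideal_quotient (ideal_preim (alg_fun (incl (gens i)))
  (span_ideal (rels i))).
by move=> /cid[Q /cid[q qP]]; exists Q, q.
Qed.

Definition presented i : algebra A := projT1 (presented_quotient i).
Definition presented_pi i : alg_hom (free_on A (gens i)) (presented i) :=
  sval (projT2 (presented_quotient i)).

Lemma presented_surj i y : exists p, presented_pi i p = y.
Proof. exact: (svalP (projT2 (presented_quotient i))).1. Qed.

Lemma presented_ker i p :
  presented_pi i p = 0 <-> ideal_span (rels i) (incl (gens i) p).
Proof. exact: (svalP (projT2 (presented_quotient i))).2. Qed.

(** Restricting the relations to the generators [gens i] gives generators of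
    the kernel: [restr] carries an expression in the relations over the free
    algebra on [X] to one over the free algebra on [gens i]. *)
Lemma presented_fg i : fg_quotient (alg_fun (presented_pi i)).
Proof.
apply/fg_quotientP; split; first exact: presented_surj.
exists (map (restr (gens i)) (rels i)) => p.
rewrite presented_ker; split=> [pr|].
  by rewrite -[p]inclK; apply: (span_map (f := alg_fun (restr (gens i)))).
apply: (span_min (ideal_preim (alg_fun (incl (gens i))) (span_ideal (rels i)))).
by move=> _ /mapP[r ri ->]; rewrite rels_supported //; apply: mem_span.
Qed.

Lemma transition_exists i j : finer i j ->
  exists t : alg_hom (presented j) (presented i), forall p,
    t (presented_pi j p) =
    presented_pi i (restr (gens i) (incl (gens j) p)).
Proof.
move=> [gij rij].
apply: (factor_alg_surjection (q := presented_pi j) (f := alg_comp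
  (presented_pi i) (alg_comp (restr (gens i)) (incl (gens j)))))
  => [|p /presented_ker pj]; first exact: presented_surj.
by apply/presented_ker; rewrite incl_restr //; apply: span_subset rij pj.
Qed.

Definition transition i j (u : finer i j) :
  alg_hom (presented j) (presented i) := sval (cid (transition_exists u)).

Lemma transitionE i j (u : finer i j) p :
  transition u (presented_pi j p) =
  presented_pi i (restr (gens i) (incl (gens j) p)).
Proof. exact: (svalP (cid (transition_exists u))). Qed.

Lemma evaluation_exists i : exists c : alg_hom (presented i) B, forall p,
  c (presented_pi i p) = free_lift b (incl (gens i) p).
Proof.
apply: (factor_alg_surjection (q := presented_pi i)
  (f := alg_comp (free_lift b) (incl (gens i))))
  => [|p /presented_ker]; first exact: presented_surj.
by apply: span_min (ideal_kernel (alg_fun (free_lift b))) _; apply: rels_kill.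
Qed.

(** Any element of [B] is the value of a polynomial in finitely many
    generators, and any element of a presented algebra which vanishes in [B]
    vanishes once it is added to the relations. *)
Lemma presentation_colimit (T : Alg A -> Prop) :
    quotient_closed T -> (forall l : seq {classic X}, T (free_on A l)) ->
    (forall y, exists p, free_lift b p = y) ->
  exists (P : proobject (opposite_site T))
    (p : forall i : pro_idx (algs P), alg_hom (stage i) B), is_colim p.
Proof.
move=> Tq Tfree bsurj.
have TP i : T (presented i) by apply: Tq (presented_fg i) (Tfree _).
have tr_id i y : transition (finer_refl i) y = y.
  by have [p <-] := presented_surj y; rewrite transitionE inclK.
have tr_comp i j k (v : finer j k) (u : finer i j) y :
    transition (finer_trans v u) y = transition u (transition v y).
  have [p <-] := presented_surj y; rewrite !transitionE incl_restr //.
  exact: v.1.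
pose P := @Proobject (opposite_site T) presentations
  (fun i => exist T (presented i) (TP i)) transition tr_id tr_comp.
pose c i := sval (cid (evaluation_exists i)).
have cE i p : c i (presented_pi i p) = free_lift b (incl (gens i) p).
  exact: (svalP (cid (evaluation_exists i))).
exists P, c; split=> [i j u x|y|i x].
- have [p <-] := presented_surj x.
  rewrite -[step u _]/(transition u _) transitionE !cE incl_restr //.
  exact: u.1.
- have [p <-] := bsurj y; have [l lp] := finite_support p.
  have sup (r : free_alg A X) : r \in [::] -> supported l r by [].
  have kill (r : free_alg A X) : r \in [::] -> free_lift b r = 0 by [].
  exists (Presentation sup kill).
  by exists (presented_pi (Presentation sup kill) (restr l p)); rewrite cE lp.
- have [p <-] := presented_surj x; rewrite cE => p0.
  have sup r : r \in incl (gens i) p :: rels i -> supported (gens i) r.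
    by rewrite inE => /orP[/eqP->|/rels_supported//]; apply: supported_incl.
  have kill r : r \in incl (gens i) p :: rels i -> free_lift b r = 0.
    by rewrite inE => /orP[/eqP->|/rels_kill].
  have u : finer (Presentation sup kill) i.
    by split=> // r; rewrite inE orbC => ->.
  exists (Presentation sup kill), u.
  rewrite -[step _ _]/(transition u _) transitionE.
  apply/presented_ker; apply: mem_span.
  by rewrite incl_restr //= inE eqxx.
Qed.

End Presentation.

Lemma fp_quotient_closed (A : comPzRingType) :
  quotient_closed (@finitely_presented A).
Proof.
move=> C D q qfg [n [P [x [r [Ppol rfg]]]]].
exists n, P, x, (alg_comp q r); split=> //.
exact: fg_quotient_comp rfg qfg.
Qed.

Lemma fp_free (A : comPzRingType) (X : finType) :
  finitely_presented (free_alg A X).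
Proof.
exists #|X|, (free_alg A X), (fun i => free_var A (enum_val i)), (alg_id _).
by split; [apply: free_polynomial | apply: fg_quotient_id].
Qed.

Lemma fgq_quotient_closed (A : comPzRingType) :
  quotient_closed (@fg_quotient_algebra A).
Proof.
move=> C D q qfg Cfg; apply: fg_quotient_comp Cfg qfg => a.
by rewrite /= alg_funE.
Qed.

(** A quotient of [A] is presented on no generators, over [A] itself as the
    polynomial algebra in no variables. *)
Lemma fgq_fp (A : comPzRingType) (C : algebra A) :
  fg_quotient_algebra C -> finitely_presented C.
Proof.
move=> Cfg; pose AA := @Algebra A A idfun.
have strP (D : algebra A) : exists f : alg_hom AA D, f =1 alg_str D.
  by unshelve eexists (@AlgHom A AA D (alg_str D) _).
have [q qE] := strP C.
exists 0, AA, (fun=> 0), q; split=> [D d|].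
  have [f fE] := strP D; exists f; split=> [[]//|g _ a].
  by rewrite fE; apply: (alg_funE g a).
exact: fg_quotient_comp (fg_quotient_id (q := idfun) _) Cfg.
Qed.

Lemma fgq_free (A : comPzRingType) (l : seq {classic void}) :
  fg_quotient_algebra (free_on A l).
Proof.
pose AA := @Algebra A A idfun.
pose r : alg_hom (free_on A l) AA :=
  free_lift (fun x : seq_sub l => match ssval x : void with end).
apply/fg_quotientP; split.
  elim/free_alg_ind=> [a|[[]]|_ [a <-]|_ _ [a <-] [a' <-]|_ _ [a <-] [a' <-]].
  - by exists a.
  - by exists (- a); rewrite rmorphN.
  - by exists (a + a'); rewrite rmorphD.
  - by exists (a * a'); rewrite rmorphM.
exists [::] => a; split=> [a0|].
  have -> : a = 0 by rewrite -[a](alg_funE r) a0 rmorph0.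
  by have [] := span_ideal (Nil A).
by apply: span_min (ideal_kernel _) _ => y; rewrite in_nil.
Qed.

Theorem proposition90 (A : comPzRingType) :
  (exists F : functor (SPEC_Dom_points A) (op (full (@domain_algebra A))),
     is_equivalence F /\
     computes_limits (op_inclusion (@finitely_presented A))
       (functor_comp (op_inclusion (@domain_algebra A)) F)) /\
  (exists F : functor (Spec_Dom_points A) (op (full (@domain_quotient A))),
     is_equivalence F /\
     computes_limits (op_inclusion (@fg_quotient_algebra A))
       (functor_comp (op_inclusion (@domain_quotient A)) F)).
Proof.
split; apply: points_as_colimits.
- by [].
- exact: fp_quotient_closed.
- by [].
- move=> B Bdom; split=> //.
  apply: (presentation_colimit (b := id) (@fp_quotient_closed A)) => [l|y].
    exact: fp_free.
  by exists (free_var A y); rewrite free_liftE.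
- exact: fgq_fp.
- exact: fgq_quotient_closed.
- move=> P L p [pc psurj _] Ldom; split=> // y.
  have [i [x <-]] := psurj y.
  have [a <-] := (svalP (@pro_obj _ P i)).1 x.
  by exists a; rewrite (alg_funE (p i)).
- move=> B [Bsurj Bdom]; split=> //.
  apply: (presentation_colimit (b := fun v : void => match v with end)
    (@fgq_quotient_closed A)) => [l|y]; first exact: fgq_free.
  have [a <-] := Bsurj y; exists (alg_str (free_alg A void) a).
  exact: alg_funE.
Qed.
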